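(* Let $q\ge 2$ be an integer and $r\ge 2$ a real number, and consider the generalized Curie-Weiss-Potts model $P_{n,\beta,r}$ with inverse temperature $\beta>0$. If $\beta<\beta_s(q,r)$, then the mixing time of its Glauber dynamics satisfies $$t_{\mathrm{mix}}=O(n\log n)\qquad(n\to\infty),$$ i.e. $t_{\mathrm{mix}}(\epsilon)=O(n\log n)$ for every fixed $\epsilon\in(0,1)$.
   Context: **Model.** Let $\Lambda=\{e^1,\dots,e^q\}$ be the standard basis of $\mathbb{R}^q$. For $\omega=(\omega_1,\dots,\omega_n)\in\Lambda^n$ let $L_n(\omega)$ be the vector with $k$-th component $\frac1n\#\{i:\omega_i=e^k\}$; it lies in the simplex $\mathcal{P}=\{\nu\in\mathbb{R}^q:\nu_k\ge0,\ \sum_k\nu_k=1\}$. Let $H^r(z)=-\frac1r\sum_{j=1}^qz_j^r$. The generalized Curie-Weiss-Potts model is the Gibbs measure $P_{n,\beta,r}$ on $\Lambda^n$ with density proportional to $\exp\{-\beta nH^r(L_n(\omega))\}$ with respect to the product measure with identical uniform marginals on $\Lambda$. **Glauber dynamics.** The Markov chain on $\Lambda^n$ which at each step selects a vertex $i\in\{1,\dots,n\}$ uniformly at random and, if the current configuration is $\sigma$, replaces the spin at $i$ by $e^k$ with probability $\exp\{-\beta nH^r(L_n(\sigma_{i,e^k}))\}/\sum_{\ell=1}^q\exp\{-\beta nH^r(L_n(\sigma_{i,e^\ell}))\}$, where $\sigma_{i,e^k}$ agrees with $\sigma$ off $i$ and has spin $e^k$ at $i$. Its stationary distribution is $P_{n,\beta,r}$.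 **Mixing time.** With $P^t(x,\cdot)$ the $t$-step transition probabilities, $d(t)=\max_{x\in\Lambda^n}\|P^t(x,\cdot)-P_{n,\beta,r}\|_{TV}$ (total variation distance), and $t_{\mathrm{mix}}(\epsilon)=\min\{t:d(t)\le\epsilon\}$. **The threshold $\beta_s$.** For $z\in\mathcal{P}$ put $g_k^r(z)=\dfrac{e^{\beta z_k^{r-1}}}{e^{\beta z_1^{r-1}}+\dots+e^{\beta z_q^{r-1}}}$ (depending on $\beta$), $k=1,\dots,q$. Then $$\beta_s(q,r):=\sup\{\beta\ge0:\ g_k^r(z)<z_k\ \text{for all } z\in\mathcal{P}\text{ such that }z_k\in(1/q,1]\}.$$ *)

(* Defs.v *)
From HB Require Import structures.
From mathcomp Require Import all_boot all_order all_algebra.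
From mathcomp Require Import all_classical all_reals all_analysis.
Set Implicit Arguments.
Unset Strict Implicit.
Unset Printing Implicit Defensive.
Import Order.TTheory GRing.Theory Num.Theory.
Local Open Scope classical_set_scope.
Local Open Scope ring_scope.

(* The spin e^k, the k-th standard basis vector of R^q, is represented by its
   index k : 'I_q; n vertices are the elements of 'I_n. *)
Definition config (q n : nat) := {ffun 'I_n -> 'I_q}.

Definition simplex (R : realType) (q : nat) : set 'rV[R]_q :=
  [set z | (forall k, 0 <= z ord0 k) /\ \sum_(k < q) z ord0 k = 1].

Definition empirical (R : realType) (q n : nat) (s : config q n) : 'rV[R]_q :=
  \row_(k < q) ((#|[pred i | s i == k]|)%:R / n%:R).

Definition hamiltonian (R : realType) (q : nat) (r : R) (z : 'rV[R]_q) : R :=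
  - r^-1 * \sum_(j < q) z ord0 j `^ r.

Definition boltzmann (R : realType) (q n : nat) (r beta : R)
    (s : config q n) : R :=
  expR (- beta * n%:R * hamiltonian r (empirical R s)).

Definition prior (R : realType) (q n : nat) (s : config q n) : R :=
  \prod_(i < n) (q%:R : R)^-1.

Definition gibbs (R : realType) (q n : nat) (r beta : R)
    (s : config q n) : R :=
  boltzmann r beta s * prior R s /
  \sum_(w : config q n) boltzmann r beta w * prior R w.

Definition update (q n : nat) (s : config q n) (i : 'I_n) (k : 'I_q)
    : config q n :=
  [ffun j => if j == i then k else s j].

Definition update_prob (R : realType) (q n : nat) (r beta : R)
    (s : config q n) (i : 'I_n) (k : 'I_q) : R :=
  boltzmann r beta (update s i k) /
  \sum_(l < q) boltzmann r beta (update s i l).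

Definition glauber (R : realType) (q n : nat) (r beta : R)
    (s s' : config q n) : R :=
  \sum_(i < n) n%:R^-1 *
    \sum_(k < q | update s i k == s') update_prob r beta s i k.

Fixpoint iter_kernel (R : realType) (T : finType) (P : T -> T -> R) (t : nat)
    (x y : T) : R :=
  if t is t'.+1 then \sum_(z : T) P x z * iter_kernel P t' z y
  else (x == y)%:R.

(* All the quantities maximised here and in [mix_dist] are nonnegative, so the
   default value 0 of the iterated maximum is harmless. *)
Definition tv_dist (R : realType) (T : finType) (mu nu : T -> R) : R :=
  \big[Num.max/0]_(A : {set T}) `|\sum_(x in A) mu x - \sum_(x in A) nu x|.

Definition mix_dist (R : realType) (q n : nat) (r beta : R) (t : nat) : R :=
  \big[Num.max/0]_(x : config q n)
    tv_dist (iter_kernel (glauber r beta) t x) (gibbs r beta).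

(* Extended-real valued, so that it would be +oo, rather than a junk finite
   value, if no t satisfied d(t) <= eps; otherwise the infimum is a minimum,
   being taken over a set of natural numbers. *)
Definition mixing_time (R : realType) (q n : nat) (r beta eps : R) : \bar R :=
  ereal_inf [set (t%:R)%:E | t in [set t : nat | mix_dist q n r beta t <= eps]].

Definition g_map (R : realType) (q : nat) (r beta : R) (z : 'rV[R]_q)
    (k : 'I_q) : R :=
  expR (beta * z ord0 k `^ (r - 1)) /
  \sum_(j < q) expR (beta * z ord0 j `^ (r - 1)).

Definition beta_s (R : realType) (q : nat) (r : R) : \bar R :=
  ereal_sup [set b%:E | b in [set b : R | 0 <= b /\
    forall z : 'rV[R]_q, simplex z -> forall k : 'I_q,
      q%:R^-1 < z ord0 k <= 1 -> g_map r b z k < z ord0 k]].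

(* Main.v *)
Require Import Defs.
From HB Require Import structures.
From mathcomp Require Import all_boot all_order all_algebra.
From mathcomp Require Import all_classical all_reals all_analysis.
From mathcomp Require Import ring lra.
Import Order.TTheory GRing.Theory Num.Theory.
Local Open Scope classical_set_scope.
Local Open Scope ring_scope.

(* Write z for the empirical vector and p = r - 1.  For beta < beta_s, comparing
   with a b in (beta, beta_s] and flattening the other coordinates by Jensen
   gives g_k(z) - 1/q <= (1 - alpha) (z_k - 1/q) whenever z_k > 1/q, and the
   slope beta p q^-p of g at the uniform vector is < 1.  The first fact makes
   V = sum_k ((z_k - 1/q)^+)^4 satisfy P V <= (1 - 3 alpha / n) V + O(n^-3), so
   V is typically O(n^-2), well below 1/n.  The second makes the coupling that
   updates the same vertex in both chains by a maximal coupling of the two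
   update laws contract the Hamming distance by 1 - kappa / n as long as both
   chains have nearly uniform empirical vectors; the failure of that event costs
   at most a constant times V.  Hence Phi = Hamming + L n (V + V') satisfies
   E Phi <= (1 - kappa / n) Phi + O(n^-2); as Phi = O(n), after (2 / kappa) n ln n
   steps E Phi = O(1 / n), which bounds the distance to stationarity.  The
   coupling is only used for one step at a time, through its effect on functions
   f with f s - f t <= A Phi(s, t) + B. *)

Set Implicit Arguments.
Unset Strict Implicit.
Unset Printing Implicit Defensive.

(** * Convexity of powers *)

Lemma le_powR2r {R : realType} (p a b : R) :
  0 <= p -> 0 <= a -> a <= b -> a `^ p <= b `^ p.
Proof.
move=> p0 a0 ab; apply: ge0_ler_powR => //; rewrite nnegrE //.
exact: le_trans ab.
Qed.

Lemma powR_le1 {R : realType} (p a : R) : 0 <= p -> 0 <= a <= 1 -> a `^ p <= 1.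
Proof.
by move=> p0 /andP[a0 a1]; rewrite -[leRHS](congr1 (fun f => f p) (@powR1 R)) le_powR2r.
Qed.

(* The tangent inequality is Young's inequality for [b] and [a `^ (p - 1)]. *)
Lemma powR_tangent {R : realType} (p a b : R) : 1 <= p -> 0 <= a -> 0 <= b ->
  a `^ p + p * a `^ (p - 1) * (b - a) <= b `^ p.
Proof.
move=> p1 a0 b0; have [->|pn1] := eqVneq p 1.
  by rewrite subrr !powRr1// powRr0; lra.
have {p1 pn1}p1 : 1 < p by rewrite lt_neqAle eq_sym pn1.
have pp : 0 < p by lra.
have pp1 : 0 < p - 1 by lra.
have := @conjugate_powR R (a `^ (p - 1)) b (p / (p - 1)) p (powR_ge0 _ _) b0
  (divr_gt0 pp pp1) pp.
have -> : (p / (p - 1))^-1 + p^-1 = 1 by field; lra.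
rewrite -powRrM [in (p - 1) * _]mulrC divfK ?gt_eqF// => /(_ erefl).
have aE : a * a `^ (p - 1) = a `^ p by rewrite mulr_powRB1.
move=> H.
have {}H : p * (a `^ (p - 1) * b) <= (p - 1) * a `^ p + b `^ p.
  have := ler_wpM2l (ltW pp) H.
  have -> // : p * (a `^ p / (p / (p - 1)) + b `^ p / p) =
    (p - 1) * a `^ p + b `^ p by field; lra.
nra.
Qed.

Lemma powR_lipschitz {R : realType} (p a b : R) : 1 <= p -> 0 <= b -> b <= a ->
  a <= 1 -> a `^ p - b `^ p <= p * (a - b).
Proof.
move=> p1 b0 ba a1; have a0 : 0 <= a by exact: le_trans ba.
have := @powR_tangent R p a b p1 a0 b0.
have A1 : a `^ (p - 1) <= 1 by apply: powR_le1; rewrite ?a0//; lra.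
have : 0 <= p * (a - b) by apply: mulr_ge0; lra.
nra.
Qed.

(** The mean value theorem for [u |-> (u + e)^r - u^r], whose derivative is bounded by
    [powR_tangent] at the exponent [r - 1 >= 1]. It supplies the Lipschitz constant of the exponents
    of the update law. *)
Lemma powR_second_difference {R : realType} (r e x y : R) :
  2 <= r -> 0 <= e -> 0 < y -> y <= x ->
  0 <= ((x + e) `^ r - x `^ r) - ((y + e) `^ r - y `^ r) <=
  r * (r - 1) * e * (x + e) `^ (r - 2) * (x - y).
Proof.
move=> r2 e0 y0 yx.
pose f (u : R) := (u + e) `^ r - u `^ r.
pose df (u : R) := r * (u + e) `^ (r - 1) - r * u `^ (r - 1).
have fd (u : R) : 0 < u -> is_derive u 1 f (df u).
  move=> u0; apply: is_deriveB; last exact: is_derive1_powR.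
  have ue : 0 < u + e by rewrite ltr_wpDr.
  have := is_derive1_powR r ue => H.
  have H2 : is_derive u 1 (fun v : R => v + e) 1.
    by apply: is_derive_eq; rewrite addr0.
  have := @is_derive1_comp R ((@powR R) ^~ r) (fun v => v + e) u _ _ H H2.
  by rewrite mulr1.
have [u||c cyx ->] := @MVT_segment R f df y x yx.
- rewrite in_itv/= => /andP[yu _]; apply: fd; exact: lt_trans yu.
- apply: derivable_within_continuous => u; rewrite in_itv/= => /andP[yu _].
  by have [] := fd u (lt_le_trans y0 yu).
move: cyx; rewrite in_itv/= => /andP[yc cx].
have c0 : 0 <= c by exact: le_trans (ltW y0) yc.
have cce : c <= c + e by rewrite lerDl.
apply/andP; split.
  apply: mulr_ge0; last by rewrite subr_ge0.
  rewrite /df -mulrBr; apply: mulr_ge0; first by lra.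
  by rewrite subr_ge0; apply: le_powR2r => //; lra.
apply: ler_wpM2r; first by rewrite subr_ge0.
rewrite /df -mulrBr -!mulrA; apply: ler_wpM2l; first by lra.
have := @powR_tangent R (r - 1) (c + e) c _ (addr_ge0 c0 e0) c0.
have -> : r - 1 - 1 = r - 2 by lra.
move=> /(_ ltac:(lra)).
have : (c + e) `^ (r - 2) <= (x + e) `^ (r - 2).
  by apply: le_powR2r; lra.
have := powR_ge0 (c + e) (r - 2).
set A := _ `^ (r - 2); set B := _ `^ (r - 2); set C := _ `^ _; set D := _ `^ _.
move=> A0 AB.
suff : (r - 1) * A * e <= (r - 1) * (e * B) by lra.
by rewrite -mulrA ler_wpM2l ?subr_ge0//; [lra|rewrite mulrC ler_wpM2l].
Qed.

(** * The mean-field drift *)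

(** Together with [0 <= b], this is the condition defining the set whose supremum is [beta_s]. *)
Definition drift_below {R : realType} (q : nat) (r b : R) :=
  forall z : 'rV[R]_q, simplex z -> forall k : 'I_q,
    q%:R^-1 < z ord0 k <= 1 -> g_map r b z k < z ord0 k.

(** The hypothesis is tested on the vector with one coordinate [x] and all others equal to [y];
    clearing the denominator with [1 - x = (q - 1) y] leaves a factor [q - 1 > 0] to cancel. *)
Lemma drift_below_flat {R : realType} (q : nat) (r b x y : R) :
  (2 <= q)%N -> drift_below q r b ->
  q%:R^-1 < x <= 1 -> x + (q%:R - 1) * y = 1 ->
  y * expR (b * x `^ (r - 1)) < x * expR (b * y `^ (r - 1)).
Proof.
move=> q2 hb xq xy; have Q2 : 2 <= q%:R :> R by rewrite (ler_nat R 2 q).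
have /andP[x1 xle] := xq.
pose k0 := Ordinal (ltnW q2).
pose z : 'rV[R]_q := \row_j if j == k0 then x else y.
have sumz (f : R -> R) : \sum_(j < q) f (z ord0 j) = f x + (q%:R - 1) * f y.
  rewrite (bigD1 k0)//= mxE eqxx; congr (_ + _).
  rewrite (eq_bigr (fun=> f y)) => [|j /negPf jk]; last by rewrite mxE jk.
  rewrite sumr_const -(natrB R (ltnW q2)) mulr_natl.
  by rewrite (@eq_card _ _ (predC1 k0))// cardC1 card_ord subn1.
have x0 : 0 < x by apply: lt_trans x1; rewrite invr_gt0; lra.
have zs : simplex z.
  split=> [k|]; last by rewrite (sumz id).
  by rewrite mxE; case: ifP => _; [exact: ltW|nra].
have zk : z ord0 k0 = x by rewrite mxE eqxx.
have := hb z zs k0; rewrite /g_map zk => /(_ xq).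
rewrite (sumz (fun u => expR (b * u `^ (r - 1)))).
have := expR_gt0 (b * x `^ (r - 1)); have := expR_gt0 (b * y `^ (r - 1)).
set A := expR _; set B := expR _ => A0 B0.
rewrite ltr_pdivrMr; nra.
Qed.

(** Lowering [b] to [beta] multiplies the right-hand side of the flat inequality by
    [exp ((b - beta) (x^(r-1) - y^(r-1)))], which turns a strict inequality into a gap linear in
    [x - y]. The factor [q^-1] comes from [x > 1/q], and [exp (- b)] from
    [x^(r-1) - y^(r-1) <= 1]. *)
Lemma drift_below_gap {R : realType} (q : nat) (r b beta x y : R) :
  (2 <= q)%N -> 2 <= r -> 0 < beta -> beta < b -> drift_below q r b ->
  q%:R^-1 < x <= 1 -> x + (q%:R - 1) * y = 1 ->
  y + q%:R^-1 * expR (- b) * (b - beta) * q%:R^-1 `^ (r - 2) * (x - y) <=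
  x * expR (- (beta * (x `^ (r - 1) - y `^ (r - 1)))).
Proof.
move=> q2 r2 b0 bb hb xq xy; have Q2 : 2 <= q%:R :> R by rewrite (ler_nat R 2 q).
have := drift_below_flat q2 hb xq xy.
have Qi0 : 0 < q%:R^-1 :> R by rewrite invr_gt0; lra.
have /andP[x1 xle] := xq.
have x0 : 0 < x by exact: lt_trans x1.
have y0 : 0 <= y by nra.
have yx : y <= x.
  rewrite leNgt; apply/negP => xy'.
  have : q%:R * q%:R^-1 < q%:R * x by rewrite ltr_pM2l//; lra.
  rewrite mulfV; nra.
have Dx1 : x `^ (r - 1) <= 1 by apply: powR_le1; [lra|rewrite xle ltW].
have Dy0 : 0 <= y `^ (r - 1) by exact: powR_ge0.
(* Write [u^(r-1) = u * u^(r-2)] and use that [x^(r-2)] dominates both [y^(r-2)] and [q^-(r-2)]. *)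
have D1 : q%:R^-1 `^ (r - 2) * (x - y) <= x `^ (r - 1) - y `^ (r - 1).
  have r20 : 0 <= r - 2 by lra.
  have E u : 0 <= u -> u `^ (r - 1) = u * u `^ (r - 2).
    move=> u0; rewrite -(@mulr_powRB1 R u (r - 1))//; last lra.
    by congr (_ * _ `^ _); lra.
  rewrite (E x (ltW x0)) (E y y0).
  have h1 := le_powR2r r20 y0 yx.
  have h2 := le_powR2r r20 (ltW Qi0) (ltW x1).
  move: (y `^ _) (_^-1 `^ _) (x `^ _) h1 h2 => U V W h1 h2.
  have : 0 <= (x - y) * (W - V) by apply: mulr_ge0; lra.
  have : 0 <= y * (W - U) by apply: mulr_ge0; lra.
  lra.
have K0 : 0 <= q%:R^-1 `^ (r - 2) by exact: powR_ge0.
move: (x `^ _) (y `^ _) (_ `^ (r - 2)) Dx1 Dy0 D1 K0.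
move=> Dx Dy K Dx1 Dy0 D1 K0 H.
set e := expR (- (beta * _)).
have {}H : y < x * expR (- (b * (Dx - Dy))).
  have e0 := expR_gt0 (- (b * Dx)).
  have -> : - (b * (Dx - Dy)) = b * Dy - b * Dx by lra.
  by rewrite expRD mulrA -(ltr_pM2r (expR_gt0 (b * Dx))) expRN mulfVK ?gt_eqF ?expR_gt0.
have eD : expR (- b) * ((b - beta) * (Dx - Dy)) <= e - expR (- (b * (Dx - Dy))).
  have -> : e = expR (- (b * (Dx - Dy))) * expR ((b - beta) * (Dx - Dy)).
    by rewrite -expRD; congr expR; lra.
  have := expR_ge1Dx ((b - beta) * (Dx - Dy)).
  have : expR (- b) <= expR (- (b * (Dx - Dy))) by rewrite ler_expR; nra.
  have := expR_gt0 (- b).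
  have : 0 <= (b - beta) * (Dx - Dy).
    have : 0 <= K * (x - y) by rewrite mulr_ge0//; lra.
    by move=> ?; apply: mulr_ge0; lra.
  set u := (b - beta) * _; set v := expR (- b); set w := expR (- _); set s := expR u.
  nra.
set w := expR (- (b * _)) in H eD.
have h3 : expR (- b) * (b - beta) * (K * (x - y)) <= e - w.
  apply: le_trans eD; rewrite -mulrA ler_pM2l ?expR_gt0//.
  by rewrite ler_pM2l// subr_gt0.
have h4 : 0 <= e - w.
  apply: le_trans h3; rewrite !mulr_ge0 ?expR_ge0//; lra.
move: h3; set G := expR (- b) * _ => h3.
have -> : q%:R^-1 * expR (- b) * (b - beta) * K * (x - y) =
  q%:R^-1 * (G * (K * (x - y))) by rewrite /G; ring.
nra.
Qed.

(** For a fixed [k]-th coordinate [x], convexity makes the denominator of [g_map] smallest when the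
    other coordinates equal their mean [y]. This reduces the claim to flat vectors, where
    [drift_below_gap] gives the constant [alpha]. *)
Lemma g_map_contraction {R : realType} (q : nat) (r b beta : R) :
  (2 <= q)%N -> 2 <= r -> 0 < beta -> beta < b -> drift_below q r b ->
  exists2 alpha : R, 0 < alpha & forall (z : 'rV[R]_q) (k : 'I_q), simplex z ->
    q%:R^-1 < z ord0 k ->
    g_map r beta z k <= q%:R^-1 + (1 - alpha) * (z ord0 k - q%:R^-1).
Proof.
move=> q2 r2 b0 bb hb; have Q2 : 2 <= q%:R :> R by rewrite (ler_nat R 2 q).
have Qi0 : 0 < q%:R^-1 :> R by rewrite invr_gt0; lra.
exists (q%:R^-1 * expR (- b) * (b - beta) * q%:R^-1 `^ (r - 2)).
  by rewrite !mulr_gt0 ?expR_gt0 ?powR_gt0 ?subr_gt0.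
move=> z k [z0 z1] zk; set x := z ord0 k.
pose y := (1 - x) / (q%:R - 1).
have yE : (q%:R - 1) * y = 1 - x by rewrite mulrC divfK//; lra.
have xy : x + (q%:R - 1) * y = 1 by lra.
have xle : x <= 1.
  rewrite -z1 (bigD1 k)//= lerDl sumr_ge0//.
have xq : q%:R^-1 < x <= 1 by rewrite zk xle.
have y0 : 0 <= y by nra.
have := drift_below_gap q2 r2 b0 bb hb xq xy.
set al := _ `^ (r - 2) in |- *; set alpha := _ * al => gap.
have alpha0 : 0 <= alpha.
  rewrite /alpha /al !mulr_ge0 ?expR_ge0 ?powR_ge0//; lra.
(* Each term is bounded below by a tangent line at [y] of [u |-> exp (beta u^(r-1))]; the linear
   parts cancel since [y] is the mean of the other coordinates. *)
have jensen : (q%:R - 1) * expR (beta * y `^ (r - 1)) <=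
    \sum_(j < q | j != k) expR (beta * z ord0 j `^ (r - 1)).
  pose c := beta * ((r - 1) * y `^ (r - 2)).
  have -> : (q%:R - 1) * expR (beta * y `^ (r - 1)) =
      \sum_(j < q | j != k)
        expR (beta * y `^ (r - 1)) * (1 + c * (z ord0 j - y)).
    rewrite -mulr_sumr big_split/= -mulr_sumr sumrB !sumr_const.
    rewrite (@eq_card _ _ (predC1 k))// cardC1 card_ord -subn1.
    have -> : \sum_(j < q | j != k) z ord0 j = 1 - x.
      by move: z1; rewrite (bigD1 k)//= -/x; lra.
    rewrite -mulr_natl -[y *+ _]mulr_natl natrB ?(ltnW q2)// yE subrr.
    by rewrite !mulr1 mulr0 addr0 mulrC.
  apply: ler_sum => j _.
  have -> : beta * z ord0 j `^ (r - 1) =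
    beta * y `^ (r - 1) + beta * (z ord0 j `^ (r - 1) - y `^ (r - 1)) by lra.
  rewrite expRD ler_pM2l ?expR_gt0//.
  apply: le_trans (expR_ge1Dx _); rewrite lerD2l /c -mulrA ler_pM2l//.
  have := @powR_tangent R (r - 1) y (z ord0 j) ltac:(lra) y0 (z0 j).
  have -> : r - 1 - 1 = r - 2 by lra.
  lra.
rewrite /g_map (bigD1 k)//= -/x.
move: gap jensen; set F := expR (- _).
have -> : expR (beta * y `^ (r - 1)) = expR (beta * x `^ (r - 1)) * F.
  by rewrite -expRD; congr expR; lra.
have F0 : 0 < F by exact: expR_gt0.
have yx : y <= x.
  rewrite leNgt; apply/negP => xy'.
  have : q%:R * q%:R^-1 < q%:R * x by rewrite ltr_pM2l//; lra.
  rewrite mulfV; nra.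
have F1 : F <= 1.
  rewrite -expR0 ler_expR oppr_le0 mulr_ge0 ?(ltW b0)// subr_ge0.
  by apply: le_powR2r => //; lra.
have := expR_gt0 (beta * x `^ (r - 1)); set A := expR _; set S := \sum_(_ < _ | _) _.
move=> A0 gap jen.
have S0 : 0 <= S by apply: sumr_ge0 => j _; exact: expR_ge0.
rewrite ler_pdivrMr; last lra.
set t := q%:R^-1 + _.
have Qq : q%:R * q%:R^-1 = 1 :> R by rewrite mulfV; lra.
have tE : t = x - alpha * (x - q%:R^-1) by rewrite /t; lra.
(* For the flattened vector, [g] equals [1 / (1 + (q - 1) F)]. The bound is the gap inequality times
   [q - 1], rewritten with [(q - 1) (x - y) = q (x - 1/q)]. *)
have h1 : 1 <= t * (1 + (q%:R - 1) * F).
  have : (q%:R - 1) * (alpha * (x - y)) <= (q%:R - 1) * (x * F - y).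
    by apply: ler_wpM2l; lra.
  have -> : (q%:R - 1) * (alpha * (x - y)) = q%:R * (alpha * (x - q%:R^-1)).
    have : (q%:R - 1) * (x - y) = q%:R * (x - q%:R^-1) by rewrite (mulrBr q%:R) Qq; lra.
    by move=> E; rewrite mulrCA E mulrCA.
  rewrite tE; have : 0 <= alpha * (x - q%:R^-1) by apply: mulr_ge0; lra.
  move: (alpha * (x - _)) => w w0 h.
  have : 0 <= (q%:R - 1) * (w * (1 - F)) by rewrite !mulr_ge0//; lra.
  lra.
have t0 : 0 < t.
  rewrite ltNge; apply/negP => tn.
  have : t * (1 + (q%:R - 1) * F) <= 0.
    by apply: mulr_le0_ge0 => //; rewrite addr_ge0// mulr_ge0; lra.
  lra.
have : A * 1 <= A * (t * (1 + (q%:R - 1) * F)) by rewrite ler_pM2l.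
have : t * ((q%:R - 1) * (A * F)) <= t * S by rewrite ler_pM2l.
rewrite mulr1; lra.
Qed.

(** The left-hand side is the slope of [g] at the uniform vector. The flat inequality for
    [y < 1/q < x] is linearised by the tangent bounds for [exp] and the power, divided by [x - y],
    and [y] is then moved up to [1/q]. *)
Lemma drift_below_slope {R : realType} (q : nat) (r b : R) :
  (2 <= q)%N -> 2 <= r -> 0 < b -> drift_below q r b ->
  b * (r - 1) * q%:R^-1 `^ (r - 1) <= 1.
Proof.
move=> q2 r2 b0 hb; have Q2 : 2 <= q%:R :> R by rewrite (ler_nat R 2 q).
have Qi0 : 0 < q%:R^-1 :> R by rewrite invr_gt0; lra.
have Qq : q%:R * q%:R^-1 = 1 :> R by rewrite mulfV; lra.
have Qi1 : q%:R^-1 <= 1 :> R by rewrite invf_le1; lra.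
have key y : 0 < y -> y < q%:R^-1 -> b * (r - 1) * y `^ (r - 1) < 1.
  move=> y0 yq; pose x := 1 - (q%:R - 1) * y.
  have yx : y < x by rewrite /x; nra.
  have xq : q%:R^-1 < x <= 1 by rewrite /x; apply/andP; split; nra.
  have := @drift_below_flat R q r b x y q2 hb xq ltac:(rewrite /x; lra).
  have x0 : 0 < x by lra.
  have := @powR_tangent R (r - 1) y x ltac:(lra) (ltW y0) (ltW x0).
  set Dx := x `^ _; rewrite -(@mulr_powRB1 R y (r - 1)) ?(ltW y0)//; last lra.
  set d := y `^ _ => tan.
  have -> : b * Dx = b * (y * d) + b * (Dx - y * d) by lra.
  rewrite expRD mulrCA mulrC ltr_pM2r ?expR_gt0// => H.
  have d0 : 0 <= d by exact: powR_ge0.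
  have := expR_ge1Dx (b * (Dx - y * d)) => H2.
  have H3 : y * (1 + b * (Dx - y * d)) < x by apply: le_lt_trans H; rewrite ler_pM2l.
  have H4 : b * ((r - 1) * d * (x - y)) <= b * (Dx - y * d) by rewrite ler_pM2l//; lra.
  have H5 : y * (b * ((r - 1) * d * (x - y))) <= y * (b * (Dx - y * d)) by rewrite ler_pM2l.
  have : (x - y) * (b * (r - 1) * (y * d)) < (x - y) * 1 by lra.
  by rewrite ltr_pM2l// subr_gt0.
rewrite leNgt; apply/negP; set X := _ * _ => X1.
pose K := b * (r - 1) * (r - 1).
have K0 : 0 < K by rewrite !mulr_gt0//; lra.
(* A quantitative limit: replacing [1/q] by [1/q - t] lowers [X] by at most [K t <= X - 1], so the
   value stays at least 1, against [key]. *)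
pose t := Num.min (q%:R^-1 / 2) ((X - 1) / K).
have t0 : 0 < t by rewrite lt_min !divr_gt0// subr_gt0.
have t1 : t <= q%:R^-1 / 2 by rewrite ge_min lexx.
have t2 : K * t <= X - 1 by rewrite mulrC -ler_pdivlMr// ge_min lexx orbT.
have := key (q%:R^-1 - t) ltac:(lra) ltac:(lra).
have := @powR_lipschitz R (r - 1) q%:R^-1 (q%:R^-1 - t) ltac:(lra) ltac:(lra)
   ltac:(lra) Qi1.
have p0 : 0 < b * (r - 1) by rewrite mulr_gt0//; lra.
rewrite opprB addrCA subrr addr0 => /(ler_wpM2l (ltW p0)).
rewrite mulrBr -/X mulrA -/K; lra.
Qed.

(** * Total variation and maximal couplings *)

Local Notation pos x := (Num.max x 0).

Lemma pos_ge0 {R : realType} (x : R) : 0 <= pos x.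
Proof. by rewrite le_max lexx orbT. Qed.

Lemma le_pos {R : realType} (x : R) : x <= pos x.
Proof. by rewrite le_max lexx. Qed.

Lemma posB {R : realType} (x y : R) : pos (x - y) - pos (y - x) = x - y.
Proof. by rewrite !maxEle; case: ifP; case: ifP; lra. Qed.

(** For probability vectors this sum is the total variation distance, the form in which it is used
    from here on. *)
Lemma sum_pos_sym {R : realType} (I : finType) (u v : I -> R) :
  \sum_k u k = \sum_k v k ->
  \sum_k pos (u k - v k) = \sum_k pos (v k - u k).
Proof.
move=> uv; apply/eqP; rewrite -subr_eq0 -sumrB.
by under eq_bigr do rewrite posB; rewrite sumrB uv subrr.
Qed.

(* With [A] the set where [w / W] exceeds [w' / W'], the left-hand side times
   [W * W'] is [(w(A) - w'(A)) * w'(~A) + w'(A) * (w'(~A) - w(~A))]; since [m]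
   and [m'] have the same mass, both differences are at most [M] times the
   same sum, whence no factor 2 is lost. *)
Lemma normalized_tv {R : realType} (I : finType) (w w' m m' : I -> R) (M : R) :
  0 < \sum_k w k -> 0 < \sum_k w' k -> (forall k, 0 <= w' k) ->
  \sum_k m k = \sum_k m' k -> 0 <= M ->
  (forall k, w k - w' k <= M * pos (m k - m' k)) ->
  (forall k, w' k - w k <= M * pos (m' k - m k)) ->
  \sum_k pos (w k / (\sum_l w l) - w' k / (\sum_l w' l)) <=
  M / (\sum_l w l) * \sum_k pos (m k - m' k).
Proof.
move=> W0 W'0 w'0 mm M0 h1 h2.
set W := \sum_l w l; set W' := \sum_l w' l; set S := \sum_k pos (m k - m' k).
pose A k := w' k / W' < w k / W.
have -> : \sum_k pos (w k / W - w' k / W') =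
    (\sum_(k | A k) w k) / W - (\sum_(k | A k) w' k) / W'.
  rewrite !mulr_suml -sumrB [RHS]big_mkcond/=; apply: eq_bigr => k _.
  by rewrite /A maxEle; case: ltP => h; case: ifP; lra.
have split_sum (u : I -> R) : \sum_k u k = \sum_(k | A k) u k + \sum_(k | ~~ A k) u k.
  by rewrite (bigID A).
have S1 : \sum_(k | A k) w k - \sum_(k | A k) w' k <= M * S.
  rewrite -sumrB mulr_sumr big_mkcond/=; apply: ler_sum => k _.
  by case: ifP => // _; rewrite mulr_ge0// pos_ge0.
have S2 : \sum_(k | ~~ A k) w' k - \sum_(k | ~~ A k) w k <= M * S.
  rewrite /S (sum_pos_sym mm) -sumrB mulr_sumr big_mkcond/=.
  apply: ler_sum => k _.
  by case: ifP => // _; rewrite mulr_ge0// pos_ge0.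
have wA : 0 <= \sum_(k | A k) w' k by exact: sumr_ge0.
have wB : 0 <= \sum_(k | ~~ A k) w' k by exact: sumr_ge0.
have WE := split_sum w; have W'E := split_sum w'; rewrite -/W -/W' in WE W'E W0 W'0.
move: (\sum_(k | A k) w k) (\sum_(k | ~~ A k) w k) (\sum_(k | A k) w' k)
  (\sum_(k | ~~ A k) w' k) S1 S2 wA wB WE W'E => a b a' b' S1 S2 wA wB WE W'E.
rewrite -(ler_pM2r W0) -(ler_pM2r W'0).
have -> : M / W * S * W * W' = M * S * W' by field; rewrite gt_eqF.
have -> : (a / W - a' / W') * W * W' = a * W' - a' * W.
  by field; rewrite !gt_eqF.
have : (a - a') * b' <= M * S * b' by rewrite ler_wpM2r.
have : a' * (b' - b) <= a' * (M * S) by rewrite ler_wpM2l.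
rewrite W'E WE; lra.
Qed.

(** The common mass [min p p'] sits on the diagonal, and the two excesses are joined by their
    product divided by the total excess [T]. *)
Lemma maximal_coupling {R : realType} (I : finType) (p p' : I -> R) :
  (forall k, 0 <= p k) -> (forall k, 0 <= p' k) ->
  \sum_k p k = \sum_k p' k ->
  exists J : I -> I -> R,
  [/\ forall k l, 0 <= J k l, forall k, \sum_l J k l = p k,
      forall l, \sum_k J k l = p' l &
      \sum_k \sum_(l | k != l) J k l <= \sum_k pos (p k - p' k)].
Proof.
move=> p0 p'0 pp; set T := \sum_k pos _.
have TE : T = \sum_k pos (p' k - p k) by exact: sum_pos_sym.
have T0 : 0 <= T by apply: sumr_ge0 => k _; exact: pos_ge0.
pose a k := pos (p k - p' k); pose b k := pos (p' k - p k).
have a0 k : 0 <= a k by exact: pos_ge0.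
have b0 k : 0 <= b k by exact: pos_ge0.
(* When [T = 0] the quotient is 0 by convention, which is still right because every excess then
   vanishes. *)
have aT k : a k * T / T = a k.
  have [T0'|Tn] := eqVneq T 0; last by rewrite mulfK.
  by rewrite T0' mulr0 mul0r (psumr_eq0P (fun k _ => a0 k) T0').
have bT k : b k * T / T = b k.
  have [T0'|Tn] := eqVneq T 0; last by rewrite mulfK.
  by rewrite T0' mulr0 mul0r (psumr_eq0P (fun k _ => b0 k) (etrans (esym TE) T0')).
have diag (c : I -> R) k : \sum_l (if k == l then c l else 0) = c k.
  by rewrite -big_mkcond/= (big_pred1 k)// => l; rewrite /= eq_sym.
pose J k l := (if k == l then Num.min (p l) (p' l) else 0) + a k * b l / T.
have minE k : Num.min (p k) (p' k) + a k = p k.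
  by rewrite /a minEle maxEle; case: ifP; case: ifP; lra.
have minE' k : Num.min (p k) (p' k) + b k = p' k.
  by rewrite /b minEle maxEle; case: ifP; case: ifP; lra.
exists J; split.
- move=> k l; apply: addr_ge0; last by rewrite !mulr_ge0// invr_ge0.
  by case: ifP => // _; rewrite le_min p0 p'0.
- move=> k; rewrite big_split/= diag -mulr_suml -mulr_sumr.
  by rewrite -/b -TE aT minE.
- move=> l; rewrite big_split/=.
  under eq_bigr do rewrite eq_sym.
  have -> : \sum_(i : I) (if l == i then Num.min (p l) (p' l) else 0) = Num.min (p l) (p' l).
    exact: (diag (fun=> Num.min (p l) (p' l))).
  have -> : \sum_(i : I) a i * b l / T = b l * T / T.
    by rewrite -!mulr_suml (mulrC (b l)).
  by rewrite bT minE'.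
- apply: ler_sum => k _; apply: (@le_trans _ _ (\sum_l a k * b l / T)).
    rewrite [leLHS]big_mkcond/=; apply: ler_sum => l _.
    rewrite /J; case: eqP => _ /=; last by rewrite add0r.
    by rewrite !mulr_ge0// invr_ge0.
  by rewrite -mulr_suml -mulr_sumr -TE aT.
Qed.

(** * Single-site updates *)

(** The part of the empirical vector due to the vertices other than [i]. It keeps the divisor [n],
    so a spin placed at [i] adds exactly [1/n] to one coordinate. *)
Definition rest {R : realType} (q n : nat) (s : config q n) (i : 'I_n)
    (k : 'I_q) : R :=
  (\sum_(j < n | j != i) (s j == k)%:R) / n%:R.

Lemma empiricalE {R : realType} (q n : nat) (s : config q n) (k : 'I_q) :
  empirical R s ord0 k = (\sum_(i < n) (s i == k)%:R) / n%:R.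
Proof.
rewrite mxE; congr (_ / _); rewrite -sum1_card natr_sum big_mkcond/=.
by apply: eq_bigr => i _; rewrite inE; case: (s i == k).
Qed.

Lemma sum_indicator {R : realType} (q : nat) (k : 'I_q) :
  \sum_(l < q) (k == l)%:R = 1 :> R.
Proof.
rewrite (bigD1 k)//= eqxx big1 ?addr0// => l /negPf.
by rewrite eq_sym => ->.
Qed.

Lemma empirical_simplex {R : realType} (q n : nat) (s : config q n) :
  (0 < n)%N -> simplex (empirical R s).
Proof.
move=> n0; split=> [k|]; first by rewrite mxE divr_ge0.
under eq_bigr do rewrite empiricalE.
rewrite -mulr_suml exchange_big/=.
under eq_bigr do rewrite sum_indicator.
by rewrite sumr_const card_ord mulfV// pnatr_eq0 -lt0n.
Qed.

Lemma rest_ge0 {R : realType} (q n : nat) (s : config q n) i k : 0 <= rest s i k :> R.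
Proof. by rewrite divr_ge0// sumr_ge0. Qed.

Lemma sum_rest {R : realType} (q n : nat) (s : config q n) (i : 'I_n) :
  \sum_(k < q) rest s i k = n.-1%:R / n%:R :> R.
Proof.
rewrite -mulr_suml exchange_big/=.
under eq_bigr do rewrite sum_indicator.
by rewrite sumr_const (@eq_card _ _ (predC1 i))// cardC1 card_ord.
Qed.

Lemma empirical_rest {R : realType} (q n : nat) (s : config q n) (i : 'I_n) (k : 'I_q) :
  empirical R s ord0 k = rest s i k + (s i == k)%:R / n%:R.
Proof. by rewrite empiricalE (bigD1 i)//= mulrDl addrC. Qed.

Lemma rest_update {R : realType} (q n : nat) (s : config q n) (i : 'I_n) (k l : 'I_q) :
  rest (update s i k) i l = rest s i l :> R.
Proof. by congr (_ / _); apply: eq_bigr => j /negPf ji; rewrite ffunE ji. Qed.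

Lemma empirical_update {R : realType} (q n : nat) (s : config q n) (i : 'I_n) (k l : 'I_q) :
  empirical R (update s i k) ord0 l = rest s i l + (k == l)%:R / n%:R.
Proof. by rewrite (empirical_rest _ i) rest_update ffunE eqxx. Qed.

Lemma rest_le {R : realType} (q n : nat) (s : config q n) (i : 'I_n) (k : 'I_q) :
  rest s i k <= empirical R s ord0 k <= rest s i k + n%:R^-1.
Proof.
rewrite (empirical_rest s i) lerDl lerD2l divr_ge0//=.
by case: (_ == _); rewrite ?mul0r ?mul1r.
Qed.

Lemma rest_le1 {R : realType} (q n : nat) (s : config q n) (i : 'I_n) (k : 'I_q) :
  rest s i k + n%:R^-1 <= 1 :> R.
Proof.
have n0 : (0 < n)%N by case: n i {s} => [[]|].
have := sum_rest (R := R) s i; rewrite (bigD1 k)//= => h.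
have : 0 <= \sum_(l < q | l != k) rest s i l :> R by rewrite sumr_ge0// => *; exact: rest_ge0.
have : n.-1%:R / n%:R + n%:R^-1 = 1 :> R.
  rewrite -{2}[n%:R^-1]mul1r -mulrDl -{2}[1](mulr1n (1 : R)) -natrD addn1 prednK//.
  by rewrite mulfV// pnatr_eq0 -lt0n.
by move: (n%:R^-1) (n.-1%:R / n%:R) h => u v; lra.
Qed.

(** The change of [- beta n H^r] when one coordinate rises from [x] to [x + 1/n]; to leading order
    it is [beta x^(r-1)], the exponent in [g_map]. *)
Definition incr {R : realType} (n : nat) (r beta x : R) : R :=
  beta * n%:R / r * ((x + n%:R^-1) `^ r - x `^ r).

Lemma incr_bounds {R : realType} (n : nat) (r beta x : R) :
  (0 < n)%N -> 2 <= r -> 0 <= beta -> 0 <= x ->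
  beta * x `^ (r - 1) <= incr n r beta x <= beta * (x + n%:R^-1) `^ (r - 1).
Proof.
move=> n0 r2 b0 x0; have N0 : 0 < n%:R :> R by rewrite ltr0n.
have e0 : 0 < n%:R^-1 :> R by rewrite invr_gt0.
have r1 : 1 <= r by lra.
have xe0 : 0 <= x + n%:R^-1 by rewrite addr_ge0// ltW.
have := powR_tangent r1 x0 xe0; have := powR_tangent r1 xe0 x0.
rewrite /incr; set X := _ `^ r; set U := _ `^ (r - 1); set Y := x `^ r.
set V := x `^ (r - 1) => h1 h2.
have c0 : 0 <= beta * n%:R / r by rewrite divr_ge0 ?mulr_ge0//; lra.
have E w : beta * w = beta * n%:R / r * (r * w * n%:R^-1).
  by field; rewrite !gt_eqF//; lra.
rewrite (E V) (E U); move: X Y U V h1 h2 => X Y U V h1 h2.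
by apply/andP; split; apply: ler_wpM2l => //; lra.
Qed.

Lemma boltzmann_update {R : realType} (q n : nat) (r beta : R)
    (s : config q n) (i : 'I_n) (k : 'I_q) :
  0 < r -> boltzmann r beta (update s i k) =
  expR (beta * n%:R / r * \sum_(j < q) rest s i j `^ r) *
  expR (incr n r beta (rest s i k)).
Proof.
move=> r0; rewrite -expRD /boltzmann /hamiltonian /incr -mulrDr.
have -> : \sum_(j < q) empirical R (update s i k) ord0 j `^ r =
    \sum_(j < q) rest s i j `^ r +
    ((rest s i k + n%:R^-1) `^ r - rest s i k `^ r).
  rewrite (bigD1 k)//= empirical_update eqxx mul1r.
  rewrite [in RHS](bigD1 k)//=.
  under eq_bigr => j /negPf jk.
    by rewrite empirical_update eq_sym jk mul0r addr0 over.
  by rewrite addrC; lra.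
by congr expR; field; rewrite gt_eqF.
Qed.

(** The weight of the spins off [i] is common to all candidates and cancels, so the update law
    depends on [s] only through [rest s i]. *)
Lemma update_probE {R : realType} (q n : nat) (r beta : R)
    (s : config q n) (i : 'I_n) (k : 'I_q) :
  0 < r -> update_prob r beta s i k =
  expR (incr n r beta (rest s i k)) /
  \sum_(l < q) expR (incr n r beta (rest s i l)).
Proof.
move=> r0; rewrite /update_prob boltzmann_update//.
under [X in _ / X]eq_bigr do rewrite boltzmann_update//.
by rewrite -mulr_sumr -mulf_div mulfV ?mul1r// gt_eqF// expR_gt0.
Qed.

Lemma sum_expR_gt0 {R : realType} (q : nat) (f : 'I_q -> R) :
  (0 < q)%N -> 0 < \sum_(l < q) expR (f l).
Proof.
move=> q0; rewrite (bigD1 (Ordinal q0))//= ltr_pwDl ?expR_gt0//.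
by apply: sumr_ge0 => j _; exact: expR_ge0.
Qed.

Lemma update_prob_ge0 {R : realType} (q n : nat) (r beta : R)
    (s : config q n) (i : 'I_n) (k : 'I_q) : 0 <= update_prob r beta s i k.
Proof.
rewrite divr_ge0 ?expR_ge0//.
by apply: sumr_ge0 => j _; exact: expR_ge0.
Qed.

Lemma sum_update_prob {R : realType} (q n : nat) (r beta : R)
    (s : config q n) (i : 'I_n) :
  (0 < q)%N -> \sum_(k < q) update_prob r beta s i k = 1.
Proof. by move=> q0; rewrite -mulr_suml mulfV// gt_eqF// sum_expR_gt0. Qed.

Definition glauber_op {R : realType} (q n : nat) (r beta : R)
    (f : config q n -> R) (s : config q n) : R :=
  \sum_(t : config q n) glauber r beta s t * f t.

Lemma glauber_opE {R : realType} (q n : nat) (r beta : R) (s : config q n)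
    (f : config q n -> R) :
  glauber_op r beta f s =
  \sum_(i < n) n%:R^-1 *
    \sum_(k < q) update_prob r beta s i k * f (update s i k).
Proof.
rewrite /glauber_op; under eq_bigr do rewrite mulr_suml.
rewrite exchange_big/=; apply: eq_bigr => i _.
under eq_bigr do rewrite -mulrA.
rewrite -mulr_sumr; congr (_ * _).
under [LHS]eq_bigr do rewrite big_mkcond/= mulr_suml.
rewrite exchange_big/=; apply: eq_bigr => k _.
rewrite (bigD1 (update s i k))//= eqxx big1 ?addr0// => t /negPf.
by rewrite eq_sym => ->; rewrite mul0r.
Qed.

Lemma expR_le_affine {R : realType} (t : R) : 0 <= t -> t <= 2^-1 -> expR t <= 1 + 2 * t.
Proof.
move=> t0 t1; have := expR_ge1Dx (- t); have := expR_gt0 t; rewrite expRN => e0.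
rewrite -(ler_pM2r e0) mulVf ?gt_eqF// => h.
have : (1 + 2 * t) * ((1 - t) * expR t) <= (1 + 2 * t) * 1 by rewrite ler_pM2l; lra.
nra.
Qed.

(** The exponents of the two laws lie in a common interval of length at most
    [th = beta (r - 1) / n], so their ratio is at most [exp (2 th) <= 1 + 4 th]. The error becomes
    additive because [g_map] is at most 1; the hypothesis on [n] gives [2 th <= 1/2]. *)
Lemma update_prob_le_g_map {R : realType} (q n : nat) (r beta : R)
    (s : config q n) (i : 'I_n) (k : 'I_q) :
  (0 < q)%N -> 2 <= r -> 0 < beta -> 4 * (beta * (r - 1)) <= n%:R ->
  update_prob r beta s i k <=
  g_map r beta (empirical R s) k + 4 * (beta * (r - 1)) / n%:R.
Proof.
move=> q0 r2 b0 hn; have n0 : (0 < n)%N by case: n i {s hn} => [[]|].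
have N0 : 0 < n%:R :> R by rewrite ltr0n.
have p0 : 0 < beta * (r - 1) by rewrite mulr_gt0//; lra.
pose th := beta * (r - 1) / n%:R.
have th0 : 0 <= th by rewrite /th divr_ge0// ltW.
have th1 : th + th <= 2^-1.
  have : 4 * th <= 1 by rewrite /th mulrA ler_pdivrMr// mul1r.
  lra.
have close l : `|incr n r beta (rest s i l) - beta * empirical R s ord0 l `^ (r - 1)| <= th.
  have /andP[h1 h2] := incr_bounds n0 r2 (ltW b0) (rest_ge0 (R := R) s i l).
  have /andP[z1 z2] := rest_le (R := R) s i l.
  have r1 : 0 <= r - 1 by lra.
  have h3 := le_powR2r r1 (rest_ge0 s i l) z1.
  have h4 := le_powR2r r1 (le_trans (rest_ge0 s i l) z1) z2.
  have r1' : 1 <= r - 1 by lra.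
  have le_r : rest s i l <= rest s i l + n%:R^-1 :> R by rewrite lerDl invr_ge0.
  have := powR_lipschitz r1' (rest_ge0 s i l) le_r (rest_le1 s i l).
  rewrite addrAC subrr add0r => h5.
  have -> : th = beta * ((r - 1) * n%:R^-1) by rewrite /th mulrA.
  have h6 : beta * ((rest s i l + n%:R^-1) `^ (r - 1) - rest s i l `^ (r - 1)) <=
    beta * ((r - 1) * n%:R^-1) by rewrite ler_pM2l.
  have h7 : beta * rest s i l `^ (r - 1) <= beta * empirical R s ord0 l `^ (r - 1).
    by rewrite ler_pM2l.
  have h8 : beta * empirical R s ord0 l `^ (r - 1) <= beta * (rest s i l + n%:R^-1) `^ (r - 1).
    by rewrite ler_pM2l.
  by rewrite ler_norml; lra.
rewrite update_probE; last lra.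
rewrite /g_map; set W := \sum_(l < q) expR (incr _ _ _ _).
set Z := \sum_(l < q) _; set A := expR (beta * _).
have W0 : 0 < W by exact: sum_expR_gt0.
have Z0 : 0 < Z by exact: sum_expR_gt0.
have A0 : 0 < A by exact: expR_gt0.
have AZ : A / Z <= 1.
  rewrite ler_pdivrMr// mul1r /Z (bigD1 k)//= lerDl.
  by apply: sumr_ge0 => j _; exact: expR_ge0.
have e1 : expR (incr n r beta (rest s i k)) <= expR th * A.
  by rewrite -expRD ler_expR; have := close k; rewrite ler_norml => /andP[? ?]; lra.
have e2 : Z <= expR th * W.
  rewrite /Z /W mulr_sumr; apply: ler_sum => l _.
  by rewrite -expRD ler_expR; have := close l; rewrite ler_norml => /andP[? ?]; lra.
have := expR_le_affine (addr_ge0 th0 th0) th1; rewrite expRD => e3.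
have AZ0 : 0 <= A / Z by rewrite divr_ge0// ltW.
apply: (@le_trans _ _ (expR th * expR th * (A / Z))); last first.
  have -> : 4 * (beta * (r - 1)) / n%:R = 4 * th by rewrite /th -mulrA.
  move: (A / Z) (expR th * expR th) AZ AZ0 e3 => a E AZ AZ0 e3.
  have : E * a <= (1 + 2 * (th + th)) * a by rewrite ler_wpM2r.
  have : 0 <= th * (1 - a) by rewrite mulr_ge0// subr_ge0.
  lra.
rewrite ler_pdivrMr// -[leRHS]mulrA.
apply: le_trans e1 _; rewrite -mulrA ler_pM2l ?expR_gt0//.
have -> : expR th * (A / Z * W) = A / Z * (expR th * W) by rewrite mulrCA.
apply: (@le_trans _ _ (A / Z * Z)); first by rewrite divfK// gt_eqF.
by rewrite ler_wpM2l.
Qed.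

(** * Drift of the potential *)

(** Squares would settle at order [1/n], too large after multiplication by [n]; fourth powers settle
    at order [n^-2]. Positive parts suffice because lower deviations are controlled through the
    total mass. *)
Definition potential {R : realType} (q n : nat) (s : config q n) : R :=
  \sum_(k < q) pos (empirical R s ord0 k - q%:R^-1) ^+ 4.

(** Since [pos (x + d) <= |pos x + d|], the binomial expansion applies. The term linear in [d] is
    kept exact, because it is the one that averages to a negative drift. *)
Lemma pos_step4 {R : realType} (x d e : R) : `|d| <= e ->
  pos (x + d) ^+ 4 <= pos x ^+ 4 + 4 * pos x ^+ 3 * d +
    (6 * pos x ^+ 2 * e ^+ 2 + 4 * pos x * e ^+ 3 + e ^+ 4).
Proof.
move=> de; have u0 := pos_ge0 x; have xu := le_pos x; set u := pos x in u0 xu *.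
have e0 : 0 <= e by exact: le_trans de.
apply: (@le_trans _ _ ((u + d) ^+ 4)).
  rewrite -[leRHS]ger0_norm ?exprn_even_ge0// normrX.
  rewrite ler_pXn2r ?nnegrE ?pos_ge0//.
  rewrite ge_max normr_ge0 andbT; apply: le_trans (ler_norm _); lra.
have d2 : d ^+ 2 <= e ^+ 2 by rewrite -real_normK ?num_real// ler_pXn2r// nnegrE.
have d3 : d ^+ 3 <= e ^+ 3.
  by apply: le_trans (ler_norm _) _; rewrite normrX ler_pXn2r// nnegrE.
have d4 : d ^+ 4 <= e ^+ 4.
  by apply: le_trans (ler_norm _) _; rewrite normrX ler_pXn2r// nnegrE.
have -> : (u + d) ^+ 4 =
  u ^+ 4 + 4 * u ^+ 3 * d + (6 * u ^+ 2 * d ^+ 2 + 4 * u * d ^+ 3 + d ^+ 4) by ring.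
have : 6 * u ^+ 2 * d ^+ 2 <= 6 * u ^+ 2 * e ^+ 2 by rewrite ler_wpM2l// mulr_ge0// exprn_ge0.
have : 4 * u * d ^+ 3 <= 4 * u * e ^+ 3 by rewrite ler_wpM2l// mulr_ge0.
lra.
Qed.

(** Coordinate by coordinate, the linear term contributes [- 4 alpha u^4 / n]. Three quarters of it
    are kept, and the last quarter absorbs the terms of order [u^2 / n^2], leaving [O(n^-3)]. *)
Lemma potential_drift {R : realType} (q n : nat) (r beta alpha : R) (s : config q n) :
  (2 <= q)%N -> 2 <= r -> 0 < beta -> 0 < alpha ->
  (forall (z : 'rV[R]_q) (k : 'I_q), simplex z -> q%:R^-1 < z ord0 k ->
    g_map r beta z k <= q%:R^-1 + (1 - alpha) * (z ord0 k - q%:R^-1)) ->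
  (0 < n)%N -> 4 * (beta * (r - 1)) <= n%:R ->
  glauber_op r beta (@potential R q n) s <=
  (1 - 3 * alpha / n%:R) * potential s +
  q%:R * ((16 * (beta * (r - 1)) + 6) ^+ 2 / (4 * alpha) + 5) / n%:R ^+ 3.
Proof.
move=> q2 r2 b0 a0 Hg n0 hn; have q0 := ltnW q2.
have N0 : 0 < n%:R :> R by rewrite ltr0n.
set c := beta * (r - 1) in hn *.
have c0 : 0 <= c by rewrite mulr_ge0//; lra.
pose e : R := n%:R^-1.
have e0 : 0 < e by rewrite invr_gt0.
have e1 : e <= 1 by rewrite invf_le1// ler1n.
have sn : \sum_(i < n) e = 1 by rewrite sumr_const card_ord -mulr_natl mulfV// gt_eqF.
rewrite glauber_opE -/e.
have -> : \sum_(i < n) e * \sum_(k < q) update_prob r beta s i k * potential (update s i k) =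
  \sum_(l < q) \sum_(i < n) e * \sum_(k < q)
     update_prob r beta s i k * pos (empirical R (update s i k) ord0 l - q%:R^-1) ^+ 4.
  rewrite exchange_big/=; apply: eq_bigr => i _; rewrite -mulr_sumr; congr (_ * _).
  rewrite exchange_big/=; apply: eq_bigr => k _.
  by rewrite -mulr_sumr.
have -> : (1 - 3 * alpha * e) * potential s +
    q%:R * ((16 * c + 6) ^+ 2 / (4 * alpha) + 5) / n%:R ^+ 3 =
    \sum_(l < q) ((1 - 3 * alpha * e) * pos (empirical R s ord0 l - q%:R^-1) ^+ 4 +
      ((16 * c + 6) ^+ 2 / (4 * alpha) + 5) * e ^+ 3).
  rewrite big_split/= -mulr_sumr sumr_const card_ord -[(_ * _) *+ q]mulr_natl; congr (_ + _).
  by rewrite /e exprVn mulrA.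
apply: ler_sum => l _.
set z := empirical R s ord0 l; set u := pos (z - q%:R^-1).
have zs := empirical_simplex (R := R) s n0.
have u0 : 0 <= u by exact: pos_ge0.
have z1 : z <= 1.
  by case: zs => [zp <-]; rewrite (bigD1 l)//= lerDl sumr_ge0.
have u1 : u <= 1.
  have : 0 < q%:R^-1 :> R by rewrite invr_gt0 ltr0n.
  by rewrite ge_max ler01 andbT; lra.
pose rho := 6 * u ^+ 2 * e ^+ 2 + 4 * u * e ^+ 3 + e ^+ 4.
have step i k : pos (empirical R (update s i k) ord0 l - q%:R^-1) ^+ 4 <=
    u ^+ 4 + 4 * u ^+ 3 * (((k == l)%:R - (s i == l)%:R) * e) + rho.
  have -> : empirical R (update s i k) ord0 l - q%:R^-1 =
      z - q%:R^-1 + ((k == l)%:R - (s i == l)%:R) * e.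
    by rewrite empirical_update /z (empirical_rest s i) /e; lra.
  apply: pos_step4; rewrite normrM (ger0_norm (ltW e0)).
  rewrite -[leRHS]mul1r ler_pM2r//.
  by case: (k == l); case: (s i == l);
    rewrite ?mulr1n ?mulr0n ?subrr ?subr0 ?sub0r ?normrN ?normr0 ?normr1.
pose p i := update_prob r beta s i l.
have step2 i : \sum_(k < q) update_prob r beta s i k *
      pos (empirical R (update s i k) ord0 l - q%:R^-1) ^+ 4 <=
    u ^+ 4 + rho + 4 * u ^+ 3 * e * (p i - (s i == l)%:R).
  apply: (@le_trans _ _ (\sum_(k < q) (update_prob r beta s i k *
     (u ^+ 4 + rho - 4 * u ^+ 3 * e * (s i == l)%:R) +
     (if k == l then 4 * u ^+ 3 * e * update_prob r beta s i k else 0)))).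
    apply: ler_sum => k _.
    apply: le_trans (ler_wpM2l (update_prob_ge0 r beta s i k) (step i k)) _.
    by case: (k == l); rewrite /=; lra.
  rewrite big_split/= -mulr_suml sum_update_prob// mul1r -big_mkcond/=.
  by rewrite big_pred1_eq /p; lra.
have mean : \sum_(i < n) e * (p i - (s i == l)%:R) <= g_map r beta (empirical R s) l + 4 * c * e - z.
  rewrite -mulr_sumr sumrB mulrBr lerB//; last first.
    by rewrite /z empiricalE mulrC.
  apply: (@le_trans _ _ (e * \sum_(i < n) (g_map r beta (empirical R s) l + 4 * c * e))).
    apply: ler_wpM2l; first exact: ltW.
    by apply: ler_sum => i _; exact: update_prob_le_g_map.
  by rewrite mulr_sumr -mulr_suml sn mul1r.
apply: (@le_trans _ _ (\sum_(i < n) e * (u ^+ 4 + rho + 4 * u ^+ 3 * e * (p i - (s i == l)%:R)))).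
  by apply: ler_sum => i _; rewrite ler_pM2l.
have -> : \sum_(i < n) e * (u ^+ 4 + rho + 4 * u ^+ 3 * e * (p i - (s i == l)%:R)) =
    u ^+ 4 + rho + 4 * u ^+ 3 * e * \sum_(i < n) e * (p i - (s i == l)%:R).
  under eq_bigr do rewrite mulrDr (mulrCA e).
  by rewrite big_split/= -mulr_suml sn mul1r mulr_sumr.
move: (\sum_(i < n) _) mean => m mean.
(* The contraction of [g_map] is available only above [1/q]; below it [u = 0] and both sides
   vanish. *)
have drift : u ^+ 3 * m <= u ^+ 3 * (4 * c * e - alpha * u).
  have [zq|zq] := lerP z q%:R^-1.
    have -> : u = 0 by apply/max_idPr; lra.
    by rewrite expr0n/= !mul0r.
  rewrite ler_wpM2l ?exprn_ge0//; apply: le_trans mean _.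
  have := Hg _ _ zs zq; rewrite -/z.
  have -> : u = z - q%:R^-1 by apply/max_idPl; lra.
  lra.
have {}drift : 4 * e * (u ^+ 3 * m) <= 4 * e * (u ^+ 3 * (4 * c * e - alpha * u)).
  by rewrite ler_wpM2l// mulr_ge0// ltW.
have h3 : 16 * c * e ^+ 2 * u ^+ 3 <= 16 * c * e ^+ 2 * u ^+ 2.
  apply: ler_wpM2l; last by rewrite exprSr ler_piMr// exprn_ge0.
  by rewrite mulr_ge0 ?exprn_ge0 ?(ltW e0)// mulr_ge0.
have h1 : e ^+ 3 * u <= e ^+ 3 by rewrite ler_piMr// exprn_ge0// ltW.
have h4 : e ^+ 4 <= e ^+ 3 by rewrite exprSr ler_piMr// exprn_ge0// ltW.
(* [16 c] comes from the error of [update_prob_le_g_map], with [u^3 <= u^2], and [6] from the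
   quadratic binomial term; the two remaining binomial terms give the constant 5. *)
pose K := 16 * c + 6.
have amgm : K * u ^+ 2 * e ^+ 2 <= alpha * e * u ^+ 4 + K ^+ 2 / (4 * alpha) * e ^+ 3.
  rewrite -subr_ge0.
  have -> : alpha * e * u ^+ 4 + K ^+ 2 / (4 * alpha) * e ^+ 3 - K * u ^+ 2 * e ^+ 2 =
    alpha * e * (u ^+ 2 - K * e / (2 * alpha)) ^+ 2 by field; rewrite gt_eqF.
  by rewrite mulr_ge0 ?sqr_ge0// mulr_ge0 ?ltW.
rewrite -/K /rho; move: (K ^+ 2 / _) amgm => L; rewrite /K => amgm.
lra.
Qed.

(** * Contraction near the uniform vector *)

Definition hamming {R : realType} (q n : nat) (s t : config q n) : R :=
  \sum_(i < n) (s i != t i)%:R.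

(** A vertex where the configurations disagree enters the positive parts only through its spin in
    [s], so it is counted once. *)
Lemma sum_pos_rest {R : realType} (q n : nat) (s t : config q n) (i : 'I_n) :
  \sum_(k < q) pos (rest s i k - rest t i k) <= hamming s t / n%:R :> R.
Proof.
apply: (@le_trans _ _ (\sum_(k < q) (\sum_(j < n) (s j != t j)%:R * (s j == k)%:R) / n%:R)).
  apply: ler_sum => k _; rewrite ge_max; apply/andP; split.
    rewrite -mulrBl ler_wpM2r ?invr_ge0// -sumrB big_mkcond/=.
    apply: ler_sum => j _; case: (j != i); case: (eqVneq (s j) (t j)) => [->|_];
      rewrite /= ?subrr ?mul0r ?mul1r//.
    by rewrite gerBl.
  by rewrite divr_ge0// sumr_ge0// => j _; rewrite mulr_ge0.
rewrite -mulr_suml exchange_big/= ler_wpM2r ?invr_ge0//.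
by apply: ler_sum => j _; rewrite -mulr_sumr sum_indicator mulr1.
Qed.

Lemma expRB_le {R : realType} (a b : R) : expR a - expR b <= expR a * (a - b).
Proof.
have := expR_ge1Dx (b - a) => h.
have -> : expR b = expR a * expR (b - a) by rewrite -expRD; congr expR; lra.
rewrite -{1}[expR a]mulr1 -mulrBr ler_pM2l ?expR_gt0//; lra.
Qed.

(** From [exp t <= 1 / (1 - t)]. It lets a slope [c < 1], perturbed by an error [t], stay below the
    midpoint between [c] and 1. *)
Lemma affine_expR_le {R : realType} (c t : R) :
  0 <= c -> c <= 1 -> 0 <= t -> t <= (1 - c) / 4 ->
  (c + t) * expR t <= (1 + c) / 2.
Proof.
move=> c0 c1 t0 tc.
have et : (1 - t) * expR t <= 1.
  apply: (@le_trans _ _ (expR (- t) * expR t)).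
    by rewrite ler_wpM2r ?expR_ge0//; exact: expR_ge1Dx.
  by rewrite -expRD addNr expR0.
apply: (@le_trans _ _ ((1 + c) / 2 * ((1 - t) * expR t))).
  rewrite mulrA ler_wpM2r ?expR_ge0//.
  have : 0 <= t * (1 - c) by rewrite mulr_ge0//; lra.
  lra.
by rewrite -[leRHS]mulr1 ler_wpM2l//; lra.
Qed.

(** All weights are values of [exp (h x)] on the interval from [lo] to [hi], so [normalized_tv]
    applies with a Lipschitz constant [M]. Near uniformity [M / W] is almost the slope [c], up to
    the error [T] treated by [affine_expR_le]. *)
Lemma update_prob_tv {R : realType} (q n : nat) (r beta eta c : R)
    (s t : config q n) (i : 'I_n) :
  (2 <= q)%N -> 2 <= r -> 0 < beta ->
  c = beta * (r - 1) * q%:R^-1 `^ (r - 1) -> c <= 1 ->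
  0 <= eta -> eta <= (2 * q%:R)^-1 ->
  2 * (beta * (r - 1) * (r - 1)) * eta <= (1 - c) / 4 ->
  (forall k, q%:R^-1 - eta <= rest s i k /\ rest s i k + n%:R^-1 <= q%:R^-1 + eta) ->
  (forall k, q%:R^-1 - eta <= rest t i k /\ rest t i k + n%:R^-1 <= q%:R^-1 + eta) ->
  \sum_(k < q) pos (update_prob r beta s i k - update_prob r beta t i k) <=
  (1 + c) / 2 * (hamming s t / n%:R).
Proof.
move=> q2 r2 b0 cE c1 eta0 etaq etac hs ht.
have Q2 : 2 <= q%:R :> R by rewrite (ler_nat R 2 q).
have Qi0 : 0 < q%:R^-1 :> R by rewrite invr_gt0; lra.
have Qi1 : q%:R^-1 <= 2^-1 :> R by rewrite lef_pV2 ?posrE; lra.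
have {}etaq : eta <= q%:R^-1 / 2 by move: etaq; rewrite invfM mulrC.
have n0 : (0 < n)%N by case: n i {s t hs ht} => [[]|].
have N0 : 0 < n%:R :> R by rewrite ltr0n.
have e0 : 0 < n%:R^-1 :> R by rewrite invr_gt0.
pose lo := q%:R^-1 - eta; pose hi := q%:R^-1 + eta.
have lo0 : 0 < lo by rewrite /lo; lra.
have hi1 : hi <= 1 by rewrite /hi; lra.
have lohi : lo <= hi by rewrite /lo /hi; lra.
have p1 : 1 <= r - 1 by lra.
have r0 : 0 < r by lra.
pose h := incr n r beta.
have incr_le x y : lo <= y -> y <= x -> x + n%:R^-1 <= hi ->
    0 <= h x - h y <= beta * (r - 1) * hi `^ (r - 2) * (x - y).
  move=> ly yx xh; have y0 : 0 < y by exact: lt_le_trans ly.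
  have /andP[h1 h2] := powR_second_difference r2 (ltW e0) y0 yx.
  rewrite /h /incr -mulrBr; move: h1 h2.
  move: (_ - _ - (_ - _)) => D h1 h2.
  have k0 : 0 <= beta * n%:R / r by rewrite divr_ge0 ?mulr_ge0 ?ltW.
  apply/andP; split; first by rewrite mulr_ge0.
  apply: (le_trans (ler_wpM2l k0 h2)).
  have -> : beta * n%:R / r * (r * (r - 1) * n%:R^-1 * (x + n%:R^-1) `^ (r - 2) * (x - y)) =
    beta * (r - 1) * (x + n%:R^-1) `^ (r - 2) * (x - y) by field; rewrite !gt_eqF.
  apply: ler_wpM2r; first by rewrite subr_ge0.
  apply: ler_wpM2l; first by rewrite mulr_ge0 ?(ltW b0)//; lra.
  by apply: le_powR2r => //; lra.
have Ehi x : lo <= x -> x + n%:R^-1 <= hi -> expR (h x) <= expR (beta * hi `^ (r - 1)).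
  move=> lx xh; rewrite ler_expR.
  have x0 : 0 <= x by lra.
  have /andP[_ h2] := incr_bounds n0 r2 (ltW b0) x0.
  apply: le_trans h2 _; rewrite ler_pM2l//; apply: le_powR2r; lra.
pose M := expR (beta * hi `^ (r - 1)) * (beta * (r - 1) * hi `^ (r - 2)).
have M0 : 0 <= M.
  by rewrite /M !mulr_ge0 ?expR_ge0 ?powR_ge0 ?(ltW b0)//; lra.
have lip x y : lo <= x -> lo <= y -> x + n%:R^-1 <= hi -> y + n%:R^-1 <= hi ->
    expR (h x) - expR (h y) <= M * pos (x - y).
  move=> lx ly xh yh; have [xy|yx] := leP x y.
    have -> : pos (x - y) = 0 by apply/max_idPr; lra.
    have /andP[h1 _] := incr_le y x lx xy yh.
    by rewrite mulr0 subr_le0 ler_expR; lra.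
  have -> : pos (x - y) = x - y by apply/max_idPl; lra.
  have /andP[h1 h2] := incr_le x y ly (ltW yx) xh.
  apply: le_trans (expRB_le _ _) _; rewrite /M -mulrA.
  by apply: ler_pM => //; exact: Ehi.
have q0 : (0 < q)%N by exact: ltnW.
have rest_sum : \sum_(k < q) rest s i k = \sum_(k < q) rest t i k :> R by rewrite !sum_rest.
pose W := \sum_(k < q) expR (h (rest s i k)).
have tv : \sum_(k < q) pos (update_prob r beta s i k - update_prob r beta t i k) <=
    M / W * \sum_(k < q) pos (rest s i k - rest t i k).
  under eq_bigr do rewrite !update_probE//.
  apply: normalized_tv => //; try exact: sum_expR_gt0.
  - by move=> k; apply: lip; [exact: (hs k).1|exact: (ht k).1|exact: (hs k).2|exact: (ht k).2].
  - by move=> k; apply: lip; [exact: (ht k).1|exact: (hs k).1|exact: (ht k).2|exact: (hs k).2].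
apply: le_trans tv _.
have W0 : 0 < W by exact: sum_expR_gt0.
apply: ler_pM; [by rewrite divr_ge0// ltW|by apply: sumr_ge0 => k _; exact: pos_ge0| |exact: sum_pos_rest].
have Wlo : q%:R * expR (beta * lo `^ (r - 1)) <= W.
  have -> : q%:R * expR (beta * lo `^ (r - 1)) = \sum_(k < q) expR (beta * lo `^ (r - 1)).
    by rewrite sumr_const card_ord mulr_natl.
  apply: ler_sum => k _; rewrite ler_expR.
  have /andP[h1 _] := incr_bounds n0 r2 (ltW b0) (rest_ge0 (R := R) s i k).
  apply: le_trans h1; rewrite ler_pM2l//; apply: le_powR2r; [lra|lra|exact: (hs k).1].
rewrite ler_pdivrMr//.
have c0 : 0 <= c by rewrite cE !mulr_ge0 ?powR_ge0 ?(ltW b0)//; lra.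
apply: (@le_trans _ _ ((1 + c) / 2 * (q%:R * expR (beta * lo `^ (r - 1))))); last first.
  by rewrite ler_pM2l//; lra.
have dhl : hi `^ (r - 1) - lo `^ (r - 1) <= (r - 1) * (2 * eta).
  have := powR_lipschitz p1 (ltW lo0) lohi hi1.
  by have -> : hi - lo = 2 * eta by rewrite /hi /lo; lra.
have dhq : hi `^ (r - 1) - q%:R^-1 `^ (r - 1) <= (r - 1) * eta.
  have := @powR_lipschitz R (r - 1) hi q%:R^-1 p1 (ltW Qi0) ltac:(rewrite /hi; lra) hi1.
  by have -> : hi - q%:R^-1 = eta by rewrite /hi; lra.
pose T := 2 * (beta * (r - 1) * (r - 1)) * eta.
have bp0 : 0 <= beta * (r - 1) by rewrite mulr_ge0 ?(ltW b0)//; lra.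
have T0 : 0 <= T.
  rewrite /T; apply: mulr_ge0 => //; apply: mulr_ge0 => //.
  by apply: mulr_ge0 => //; exact: le_trans ler01 p1.
have hE : hi `^ (r - 1) = hi * hi `^ (r - 2).
  rewrite -(@mulr_powRB1 R hi (r - 1)) ?(le_trans (ltW lo0) lohi)//; last lra.
  by congr (_ * _ `^ _); lra.
(* Since [hi >= 1/q], passing from [hi^(r-1)] to [hi^(r-2)] costs at most a factor [q], which the
   [q] terms of [W] compensate. *)
have slope : beta * (r - 1) * hi `^ (r - 2) <= (c + T) * q%:R.
  have h1 : beta * (r - 1) * hi `^ (r - 1) <= c + T.
    have := ler_wpM2l bp0 dhq; rewrite mulrBr -cE /T.
    have : 0 <= beta * (r - 1) * (r - 1) * eta.
      apply: mulr_ge0 => //; apply: mulr_ge0 => //; exact: le_trans ler01 p1.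
    lra.
  have h2 : beta * (r - 1) * hi `^ (r - 2) * q%:R^-1 <= beta * (r - 1) * hi `^ (r - 1).
    rewrite hE -mulrA; apply: ler_wpM2l => //; rewrite mulrC ler_wpM2r ?powR_ge0// /hi.
    by rewrite lerDl.
  by rewrite -ler_pdivrMr; [exact: le_trans h2 h1|lra].
have ex : expR (beta * hi `^ (r - 1)) <= expR (beta * lo `^ (r - 1)) * expR T.
  rewrite -expRD ler_expR; have := ler_wpM2l (ltW b0) dhl; rewrite mulrBr.
  have -> : beta * ((r - 1) * (2 * eta)) = 2 * (beta * (r - 1)) * eta by ring.
  have : 2 * (beta * (r - 1)) * eta <= T.
    by rewrite /T ler_wpM2r// ler_wpM2l// ler_peMr.
  lra.
have main : (c + T) * expR T <= (1 + c) / 2 by exact: affine_expR_le.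
rewrite /M; apply: (le_trans (ler_pM (expR_ge0 _) _ ex slope)).
  by rewrite mulr_ge0 ?powR_ge0.
have := expR_ge0 (beta * lo `^ (r - 1)); move: (expR (beta * lo `^ _)) => E E0.
have -> : E * expR T * ((c + T) * q%:R) = (c + T) * expR T * (q%:R * E) by ring.
by rewrite ler_wpM2r// mulr_ge0//; lra.
Qed.

(** * One step of the coupled chains *)

Lemma hamming_update {R : realType} (q n : nat) (s t : config q n) (i : 'I_n) (k l : 'I_q) :
  hamming (update s i k) (update t i l) =
  hamming s t - (s i != t i)%:R + (k != l)%:R :> R.
Proof.
rewrite /hamming (bigD1 i)//= !ffunE eqxx [\sum_(j < n) _ in RHS](bigD1 i)//=.
under eq_bigr => j /negPf ji do rewrite !ffunE ji.
by rewrite (addrC (s i != t i)%:R) addrK addrC.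
Qed.

(** The hypothesis on [f] is integrated against the maximal coupling of the two update laws at [i]:
    the old disagreement at [i] is erased, and a new one appears with probability at most the total
    variation. *)
Lemma update_coupling {R : realType} (q n : nat) (r beta : R)
    (f V : config q n -> R) (A a B : R) (s t : config q n) (i : 'I_n) :
  (0 < q)%N -> 0 <= A ->
  (forall s t, f s - f t <= A * (hamming s t + a * (V s + V t)) + B) ->
  \sum_(k < q) update_prob r beta s i k * f (update s i k) -
  \sum_(k < q) update_prob r beta t i k * f (update t i k) <=
  A * (hamming s t - (s i != t i)%:R +
       \sum_(k < q) pos (update_prob r beta s i k - update_prob r beta t i k) +
       a * (\sum_(k < q) update_prob r beta s i k * V (update s i k) +
            \sum_(k < q) update_prob r beta t i k * V (update t i k))) + B.
Proof.
move=> q0 A0 hf.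
have [J [J0 Js Jt Jd]] := maximal_coupling (update_prob_ge0 r beta s i)
  (update_prob_ge0 r beta t i)
  (etrans (sum_update_prob r beta s i q0) (esym (sum_update_prob r beta t i q0))).
have rowE (g : config q n -> R) : \sum_(k < q) update_prob r beta s i k * g (update s i k) =
    \sum_k \sum_l J k l * g (update s i k).
  by apply: eq_bigr => k _; rewrite -mulr_suml Js.
have colE (g : config q n -> R) : \sum_(k < q) update_prob r beta t i k * g (update t i k) =
    \sum_k \sum_l J k l * g (update t i l).
  by rewrite exchange_big/=; apply: eq_bigr => k _; rewrite -mulr_suml Jt.
have J1 : \sum_k \sum_l J k l = 1.
  by under eq_bigr do rewrite Js; exact: sum_update_prob.
rewrite (rowE f) (colE f) (rowE V) (colE V).
pose D := hamming s t - (s i != t i)%:R : R.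
apply: (@le_trans _ _ (\sum_k \sum_l (J k l * (A * D + B) +
   A * (if k != l then J k l else 0) +
   A * a * (J k l * V (update s i k)) + A * a * (J k l * V (update t i l))))).
  rewrite -sumrB; apply: ler_sum => k _; rewrite -sumrB; apply: ler_sum => l _.
  rewrite -mulrBr; apply: (le_trans (ler_wpM2l (J0 k l) (hf _ _))).
  by rewrite hamming_update -/D; case: (k != l); rewrite /=; lra.
under eq_bigr do rewrite !big_split/= -mulr_suml -!mulr_sumr -big_mkcond/=.
rewrite !big_split/= -mulr_suml J1 -!mulr_sumr -/D.
have := ler_wpM2l A0 Jd.
move: (\sum_k \sum_(l | k != l) J k l) (\sum_k pos _)
  (\sum_k \sum_l J k l * V (update s i k)) (\sum_k \sum_l J k l * V (update t i l)).
clearbody D; clear => X Y U W; lra.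
Qed.

(** Both chains select the same vertex; averaging over it, the erased disagreements amount to
    [hamming s t / n]. *)
Lemma glauber_coupling {R : realType} (q n : nat) (r beta : R)
    (f V : config q n -> R) (A a B : R) (s t : config q n) :
  (0 < q)%N -> (0 < n)%N -> 0 <= A ->
  (forall s t, f s - f t <= A * (hamming s t + a * (V s + V t)) + B) ->
  glauber_op r beta f s - glauber_op r beta f t <=
  A * ((1 - n%:R^-1) * hamming s t +
       \sum_(i < n) n%:R^-1 *
         \sum_(k < q) pos (update_prob r beta s i k - update_prob r beta t i k) +
       a * (glauber_op r beta V s + glauber_op r beta V t)) + B.
Proof.
move=> q0 n0 A0 hf; have N0 : n%:R != 0 :> R by rewrite pnatr_eq0 -lt0n.
rewrite !glauber_opE -sumrB.
pose h : R := hamming s t; pose d i : R := (s i != t i)%:R.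
pose T i := \sum_(k < q) pos (update_prob r beta s i k - update_prob r beta t i k).
pose P i := \sum_(k < q) update_prob r beta s i k * V (update s i k).
pose Q i := \sum_(k < q) update_prob r beta t i k * V (update t i k).
apply: (@le_trans _ _ (\sum_(i < n)
    n%:R^-1 * (A * (h - d i + T i + a * (P i + Q i)) + B))).
  apply: ler_sum => i _; rewrite -mulrBr ler_pM2l ?invr_gt0 ?ltr0n//.
  exact: update_coupling.
have sn : \sum_(i < n) n%:R^-1 = 1 :> R.
  by rewrite sumr_const card_ord -[LHS]mulr_natr mulVf.
have -> : \sum_(i < n) n%:R^-1 * (A * (h - d i + T i + a * (P i + Q i)) + B) =
    \sum_(i < n) ((A * h + B) * n%:R^-1 - A * (n%:R^-1 * d i) +
      A * (n%:R^-1 * T i) + A * a * (n%:R^-1 * P i) + A * a * (n%:R^-1 * Q i)).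
  by apply: eq_bigr => i _; ring.
rewrite !big_split/= sumrN -!mulr_sumr sn -/h.
rewrite le_eqVlt; apply/orP; left; apply/eqP; rewrite /d -/(hamming s t) -/h.
ring.
Qed.

Lemma potential_ge0 {R : realType} (q n : nat) (s : config q n) : 0 <= potential s :> R.
Proof. by apply: sumr_ge0 => k _; rewrite exprn_ge0// pos_ge0. Qed.

Lemma potential_ge {R : realType} (q n : nat) (s : config q n) (k : 'I_q) (d : R) :
  0 <= d -> q%:R^-1 + d < empirical R s ord0 k -> d ^+ 4 <= potential s.
Proof.
move=> d0 zd; rewrite /potential (bigD1 k)//=.
apply: (@le_trans _ _ (pos (empirical R s ord0 k - q%:R^-1) ^+ 4)).
  rewrite lerXn2r ?nnegrE ?pos_ge0//; apply: le_trans (le_pos _); lra.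
by rewrite lerDl; apply: sumr_ge0 => j _; rewrite exprn_ge0// pos_ge0.
Qed.

(** Upper bounds on all coordinates give the lower bound [1/q - (q - 1) d], since they sum to 1.
    Half of [eta] covers this deviation, the other half the [1/n] due to vertex [i]. *)
Lemma rest_near_uniform {R : realType} (q n : nat) (s : config q n) (i : 'I_n) (d eta : R) :
  (2 <= q)%N -> 0 <= d -> 2 * q%:R * d <= eta -> 2 / eta <= n%:R -> 0 < eta ->
  (forall k, empirical R s ord0 k <= q%:R^-1 + d) ->
  forall k, q%:R^-1 - eta <= rest s i k /\ rest s i k + n%:R^-1 <= q%:R^-1 + eta.
Proof.
move=> q2 d0 dq neta eta0 hz k.
have Q2 : 2 <= q%:R :> R by rewrite (ler_nat R 2 q).
have n0 : (0 < n)%N by case: n i {s neta hz} => [[]|].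
have N0 : 0 < n%:R :> R by rewrite ltr0n.
have {}neta : n%:R^-1 <= eta / 2.
  by rewrite -[eta / 2]invrK lef_pV2 ?posrE ?invr_gt0 ?divr_gt0// invfM invrK mulrC.
have /andP[z1 z2] := rest_le (R := R) s i k.
have dq2 : q%:R * d <= eta / 2 by lra.
have zlo : q%:R^-1 - (q%:R - 1) * d <= empirical R s ord0 k.
  have [_] := empirical_simplex (R := R) s n0; rewrite (bigD1 k)//=.
  have : \sum_(j < q | j != k) empirical R s ord0 j <=
      \sum_(j < q | j != k) (q%:R^-1 + d) by exact: ler_sum.
  rewrite sumr_const (@eq_card _ _ (predC1 k))// cardC1 card_ord -subn1.
  rewrite -[_ *+ (q - 1)]mulr_natl natrB ?(ltnW q2)//.
  have : q%:R * q%:R^-1 = 1 :> R by rewrite mulfV; lra.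
  move: (q%:R^-1) => u; lra.
have dqd : d <= q%:R * d by rewrite ler_peMl//; lra.
by have := hz k; split; lra.
Qed.

(* When both empirical vectors are near uniform, the maximal couplings contract;
   otherwise the total variation is at most 1, which the potentials pay for. *)
Lemma mean_update_tv {R : realType} (q n : nat) (r beta eta c : R) (s t : config q n) :
  (2 <= q)%N -> (0 < n)%N -> 2 <= r -> 0 < beta ->
  c = beta * (r - 1) * q%:R^-1 `^ (r - 1) -> c <= 1 ->
  0 < eta -> eta <= (2 * q%:R)^-1 ->
  2 * (beta * (r - 1) * (r - 1)) * eta <= (1 - c) / 4 -> 2 / eta <= n%:R ->
  \sum_(i < n) n%:R^-1 *
    \sum_(k < q) pos (update_prob r beta s i k - update_prob r beta t i k) <=
  (1 + c) / 2 * (hamming s t / n%:R) +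
  (potential s + potential t) / (eta / (2 * q%:R)) ^+ 4.
Proof.
move=> q2 n0 r2 b0 cE c1 eta0 etaq etac neta.
have Q2 : 2 <= q%:R :> R by rewrite (ler_nat R 2 q).
have N0 : 0 < n%:R :> R by rewrite ltr0n.
set d := eta / (2 * q%:R).
have d0 : 0 < d by rewrite divr_gt0// mulr_gt0//; lra.
have dE : 2 * q%:R * d <= eta by rewrite /d mulrC divfK// mulf_neq0//; lra.
have c0 : 0 <= c by rewrite cE mulr_ge0 ?powR_ge0// mulr_ge0 ?(ltW b0)//; lra.
have h0 : 0 <= (1 + c) / 2 * (hamming s t / n%:R).
  rewrite mulr_ge0//; first lra.
  by rewrite divr_ge0// sumr_ge0.
have d40 : 0 < d ^+ 4 by rewrite exprn_gt0.
have mean (F : 'I_n -> R) (x : R) : (forall i, F i <= x) -> \sum_(i < n) n%:R^-1 * F i <= x.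
  move=> Fx; apply: (@le_trans _ _ (\sum_(i < n) n%:R^-1 * x)).
    by apply: ler_sum => i _; rewrite ler_pM2l ?invr_gt0.
  by rewrite sumr_const card_ord -[leLHS]mulr_natr mulrAC mulVf ?mul1r// gt_eqF.
have [|] := pselect (forall k, empirical R s ord0 k <= q%:R^-1 + d /\
                              empirical R t ord0 k <= q%:R^-1 + d).
  move=> good; apply: (@le_trans _ _ ((1 + c) / 2 * (hamming s t / n%:R))).
    apply: mean => i; apply: (@update_prob_tv _ _ _ _ _ eta) => //.
    - exact: ltW.
    - by apply: (@rest_near_uniform _ _ _ _ _ d) => //; [exact: ltW|move=> k; exact: (good k).1].
    - by apply: (@rest_near_uniform _ _ _ _ _ d) => //; [exact: ltW|move=> k; exact: (good k).2].
  by rewrite lerDl divr_ge0 ?(ltW d40)// addr_ge0// potential_ge0.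
move=> bad; have tv1 : \sum_(i < n) n%:R^-1 *
    \sum_(k < q) pos (update_prob r beta s i k - update_prob r beta t i k) <= 1.
  apply: mean => i; rewrite -(sum_update_prob r beta s i (ltnW q2)).
  apply: ler_sum => k _; rewrite ge_max gerBl.
  by apply/andP; split; exact: update_prob_ge0.
apply: (le_trans tv1); rewrite -[leLHS]add0r lerD// ler_pdivlMr// mul1r.
have vs0 := potential_ge0 (R := R) s; have vt0 := potential_ge0 (R := R) t.
have [k] : exists k, ~ (empirical R s ord0 k <= q%:R^-1 + d /\
                        empirical R t ord0 k <= q%:R^-1 + d).
  by apply/existsNP.
move=> /not_andP[|] /negP; rewrite -ltNge => zk.
  by apply: le_trans (potential_ge (ltW d0) zk) _; rewrite lerDl.
by apply: le_trans (potential_ge (ltW d0) zk) _; rewrite lerDr.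
Qed.

(** The functional form of a one-step contraction of the combined distance, with constants uniform
    in [n]; it can be iterated without building a coupling of whole trajectories. *)
Lemma glauber_contraction {R : realType} (q : nat) (r beta b : R) :
  (2 <= q)%N -> 2 <= r -> 0 < beta -> beta < b -> drift_below q r b ->
  exists kappa L E N : R, [/\ 0 < kappa, 0 <= L, 0 <= E &
    forall n : nat, N <= n%:R -> forall (f : config q n -> R) (A B : R),
    0 <= A ->
    (forall s t : config q n,
      f s - f t <= A * (hamming s t + L * n%:R * (potential s + potential t)) + B) ->
    forall s t : config q n,
    glauber_op r beta f s - glauber_op r beta f t <=
    A * ((1 - kappa / n%:R) *
      (hamming s t + L * n%:R * (potential s + potential t)) + E / n%:R ^+ 2) + B].
Proof.
move=> q2 r2 b0 bb hb; have Q2 : 2 <= q%:R :> R by rewrite (ler_nat R 2 q).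
have [alpha a0 Hg] := g_map_contraction q2 r2 b0 bb hb.
have := drift_below_slope q2 r2 (lt_trans b0 bb) hb.
pose c := beta * (r - 1) * q%:R^-1 `^ (r - 1).
have Qi0 : 0 < q%:R^-1 :> R by rewrite invr_gt0; lra.
have P0 := powR_gt0 (r - 1) Qi0.
have p0 : 0 < r - 1 by lra.
have cE : c = beta * ((r - 1) * q%:R^-1 `^ (r - 1)) by rewrite /c mulrA.
have c0 : 0 <= c by rewrite cE !mulr_ge0// ltW.
(* At [b] the slope is only known to be at most 1; strictness at [beta] comes from [beta < b]. *)
rewrite -mulrA => slope_b; have c1 : c < 1.
  by rewrite cE; apply: lt_le_trans slope_b; rewrite ltr_pM2r// mulr_gt0.
pose K := 2 * (beta * (r - 1) * (r - 1)).
have K0 : 0 < K by rewrite !mulr_gt0.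
pose eta := Num.min (2 * q%:R)^-1 ((1 - c) / 4 / K).
have eta0 : 0 < eta.
  by rewrite lt_min invr_gt0 mulr_gt0 ?divr_gt0//; lra.
have etaq : eta <= (2 * q%:R)^-1 by rewrite ge_min lexx.
have etac : K * eta <= (1 - c) / 4.
  by rewrite mulrC -ler_pdivlMr// ge_min lexx orbT.
pose d4 := (eta / (2 * q%:R)) ^+ 4.
have d40 : 0 < d4 by rewrite exprn_gt0// divr_gt0// mulr_gt0//; lra.
(* The potential term loses [3 alpha L (V + V')] per step. With this [L], a share [2 alpha L] pays
   for the non-uniform case, and the remaining [alpha L] still covers the rate [kappa]. *)
pose L := (2 * alpha * d4)^-1.
have L0 : 0 < L by rewrite invr_gt0 mulr_gt0// mulr_gt0.
have LE : d4^-1 = 2 * alpha * L by rewrite /L; field; rewrite !gt_eqF.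
pose kappa := Num.min alpha ((1 - c) / 2).
have k0 : 0 < kappa by rewrite lt_min a0 divr_gt0//; lra.
have ka : kappa <= alpha by rewrite ge_min lexx.
have kc : kappa <= (1 - c) / 2 by rewrite ge_min lexx orbT.
pose C := q%:R * ((16 * (beta * (r - 1)) + 6) ^+ 2 / (4 * alpha) + 5).
have C0 : 0 <= C.
  rewrite mulr_ge0// addr_ge0// divr_ge0 ?sqr_ge0//.
  by rewrite mulr_ge0// ltW.
exists kappa, L, (2 * L * C), (Num.max 1 (Num.max (4 * (beta * (r - 1))) (2 / eta))).
split=> //; [exact: ltW|by rewrite mulr_ge0// mulr_ge0// ltW|].
move=> n; rewrite !ge_max => /and3P[n1 n4 neta] f A B A0 hf s t.
have n0 : (0 < n)%N by move: n1; rewrite ler1n.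
have N0 : 0 < n%:R :> R by rewrite ltr0n.
have step := @glauber_coupling R q n r beta f (@potential R q n) A (L * n%:R) B s t
  (ltnW q2) n0 A0 hf.
apply: (le_trans step).
rewrite lerD2r; apply: ler_wpM2l => //.
have tv := @mean_update_tv R q n r beta eta c s t q2 n0 r2 b0 erefl (ltW c1) eta0 etaq etac neta.
have ds := potential_drift s q2 r2 b0 a0 Hg n0 n4.
have dt := potential_drift t q2 r2 b0 a0 Hg n0 n4.
rewrite -/C in ds dt; rewrite -/d4 LE in tv.
have h0 : 0 <= hamming s t :> R by exact: sumr_ge0.
have vs0 := potential_ge0 (R := R) s; have vt0 := potential_ge0 (R := R) t.
set TV : R := \sum_(i < n) _ in tv *.
move: (glauber_op _ _ _ s) (glauber_op _ _ _ t) TV (hamming s t)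
  (potential s) (potential t) ds dt tv h0 vs0 vt0.
move=> PVs PVt TV h Vs Vt ds dt tv h0 vs0 vt0.
have LN0 : 0 <= L * n%:R by rewrite mulr_ge0 ?(ltW L0).
have {ds dt} := ler_wpM2l LN0 (lerD ds dt).
have -> : L * n%:R * ((1 - 3 * alpha / n%:R) * Vs + C / n%:R ^+ 3 +
    ((1 - 3 * alpha / n%:R) * Vt + C / n%:R ^+ 3)) =
  L * n%:R * (Vs + Vt) - 3 * alpha * L * (Vs + Vt) + 2 * L * C / n%:R ^+ 2.
  by field; rewrite gt_eqF.
have -> : (1 - kappa / n%:R) * (h + L * n%:R * (Vs + Vt)) =
  h - kappa * (h / n%:R) + L * n%:R * (Vs + Vt) - kappa * (L * (Vs + Vt)).
  by field; rewrite gt_eqF.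
have -> : (1 - n%:R^-1) * h = h - h / n%:R by rewrite mulrBl mul1r mulrC.
have hn : 0 <= h / n%:R by rewrite divr_ge0.
have h1 : kappa * (h / n%:R) <= (1 - c) / 2 * (h / n%:R) by rewrite ler_wpM2r.
have h2 : kappa * (L * (Vs + Vt)) <= alpha * (L * (Vs + Vt)).
  by rewrite ler_wpM2r// mulr_ge0 ?(ltW L0)// addr_ge0.
move: (h / n%:R) (L * n%:R) (2 * L * C / n%:R ^+ 2) tv hn h1 h2 => x y z tv hn h1 h2.
clear -tv hn h1 h2; clearbody kappa L c.
lra.
Qed.

Lemma hamming_le {R : realType} (q n : nat) (s t : config q n) : hamming s t <= n%:R :> R.
Proof.
rewrite -[in leRHS](card_ord n) -sumr_const; apply: ler_sum => i _.
by case: (_ != _).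
Qed.

Lemma potential_le {R : realType} (q n : nat) (s : config q n) :
  (0 < n)%N -> potential s <= q%:R :> R.
Proof.
move=> n0; rewrite -[in leRHS](card_ord q) -sumr_const; apply: ler_sum => k _.
apply: exprn_ile1; first exact: pos_ge0.
rewrite ge_max ler01 andbT.
apply: (@le_trans _ _ (empirical R s ord0 k)); first by rewrite gerBl invr_ge0.
have [zp <-] := empirical_simplex (R := R) s n0; rewrite (bigD1 k)//=.
by rewrite lerDl; apply: sumr_ge0.
Qed.

(** * Stationarity *)

Lemma iter_kernelS {R : realType} (T : finType) (P : T -> T -> R) (A : {set T}) (t : nat) (x : T) :
  \sum_(y in A) iter_kernel P t.+1 x y =
  \sum_z P x z * \sum_(y in A) iter_kernel P t z y.
Proof.
by rewrite exchange_big/=; apply: eq_bigr => z _; rewrite mulr_sumr.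
Qed.

Lemma iter_kernel0 {R : realType} (T : finType) (P : T -> T -> R) (A : {set T}) (x : T) :
  \sum_(y in A) iter_kernel P 0 x y = (x \in A)%:R.
Proof.
rewrite big_mkcond/= (bigD1 x)//= eqxx big1 ?addr0; first by case: (x \in A).
by move=> y /negPf; rewrite eq_sym => ->; rewrite if_same.
Qed.

Lemma stationary_iter {R : realType} (T : finType) (P : T -> T -> R) (mu : T -> R)
    (A : {set T}) (t : nat) :
  (forall y, \sum_x mu x * P x y = mu y) ->
  \sum_x mu x * (\sum_(y in A) iter_kernel P t x y) = \sum_(x in A) mu x.
Proof.
move=> st; elim: t => [|t IH].
  under eq_bigr do rewrite iter_kernel0.
  by rewrite [RHS]big_mkcond/=; apply: eq_bigr => x _; case: (x \in A); rewrite ?mulr1 ?mulr0.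
rewrite -IH; under eq_bigr do rewrite iter_kernelS mulr_sumr.
rewrite exchange_big/=; apply: eq_bigr => z _.
by rewrite -[in RHS](st z) mulr_suml; apply: eq_bigr => x _; rewrite mulrA.
Qed.

Lemma boltzmann_gt0 {R : realType} (q n : nat) (r beta : R) (s : config q n) :
  0 < boltzmann r beta s.
Proof. exact: expR_gt0. Qed.

Lemma prior_gt0 {R : realType} (q n : nat) (s : config q n) :
  (0 < q)%N -> 0 < prior R s.
Proof. by move=> q0; apply: prodr_gt0 => i _; rewrite invr_gt0 ltr0n. Qed.

Lemma partition_gt0 {R : realType} (q n : nat) (r beta : R) :
  (0 < q)%N -> 0 < \sum_(w : config q n) boltzmann r beta w * prior R w.
Proof.
move=> q0; rewrite (bigD1 [ffun=> Ordinal q0])//=.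
rewrite ltr_pwDl ?mulr_gt0 ?boltzmann_gt0 ?prior_gt0//.
by apply: sumr_ge0 => w _; rewrite mulr_ge0// ltW ?boltzmann_gt0 ?prior_gt0.
Qed.

Lemma gibbs_ge0 {R : realType} (q n : nat) (r beta : R) (s : config q n) :
  (0 < q)%N -> 0 <= gibbs r beta s.
Proof.
move=> q0; rewrite divr_ge0 ?(ltW (partition_gt0 _ _ _ q0))//.
by rewrite mulr_ge0// ltW ?boltzmann_gt0 ?prior_gt0.
Qed.

Lemma sum_gibbs {R : realType} (q n : nat) (r beta : R) :
  (0 < q)%N -> \sum_(s : config q n) gibbs r beta s = 1.
Proof. by move=> q0; rewrite -mulr_suml mulfV// gt_eqF// partition_gt0. Qed.

Lemma update_invol (q n : nat) (s t : config q n) (i : 'I_n) (k : 'I_q) :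
  update s i k = t -> update t i (s i) = s /\ k = t i.
Proof.
move=> <-; split; last by rewrite ffunE eqxx.
by apply/ffunP => j; rewrite !ffunE; case: eqP => // ->.
Qed.

(** If one update at [i] leads from [s] to [t], the two agree off [i] and share the same normaliser;
    otherwise both sums are empty. *)
Lemma site_detailed_balance {R : realType} (q n : nat) (r beta : R)
    (s t : config q n) (i : 'I_n) :
  boltzmann r beta s * (\sum_(k < q | update s i k == t) update_prob r beta s i k) =
  boltzmann r beta t * (\sum_(k < q | update t i k == s) update_prob r beta t i k).
Proof.
have updu (x y : config q n) k l : update x i k = y -> update y i l = update x i l.
  by move=> <-; apply/ffunP => j; rewrite !ffunE; case: (j == i).
have upd2 (x y : config q n) k : update x i k = y ->
    \sum_(l < q) boltzmann r beta (update y i l) =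
    \sum_(l < q) boltzmann r beta (update x i l).
  by move=> xy; apply: eq_bigr => l _; rewrite (updu x y k).
have upd (x y : config q n) k : update x i k = y ->
    \sum_(k < q | update x i k == y) update_prob r beta x i k =
    boltzmann r beta y / \sum_(l < q) boltzmann r beta (update x i l).
  move=> xy; rewrite (big_pred1 k) => [|l]; first by rewrite /update_prob xy.
  have [_ kE] := update_invol xy.
  by apply/eqP/eqP => [/update_invol[_ ->]|->].
have [/existsP[k /eqP st]|no] := boolP [exists k, update s i k == t].
  have [ts _] := update_invol st.
  rewrite [X in _ * X = _](upd s t k st) [X in _ = _ * X](upd t s (s i) ts).
  rewrite [X in _ = _ * (_ / X)](upd2 s t k st).
  by move: (boltzmann r beta s) (boltzmann r beta t) => x y; rewrite mulrCA.
have nst k : (update s i k == t) = false.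
  by apply/negP => H; move/negP: no; apply; apply/existsP; exists k.
have nts k : (update t i k == s) = false.
  apply/negP => /eqP H; have [st _] := update_invol H.
  by move: (nst (t i)); rewrite st eqxx.
rewrite [X in _ * X = _](big_pred0 _ _ _ _ nst) [X in _ = _ * X](big_pred0 _ _ _ _ nts).
by move: (boltzmann r beta s) (boltzmann r beta t) => x y; rewrite !mulr0.
Qed.

Lemma sum_glauber {R : realType} (q n : nat) (r beta : R) (s : config q n) :
  (0 < q)%N -> (0 < n)%N -> \sum_t glauber r beta s t = 1.
Proof.
move=> q0 n0; transitivity (glauber_op r beta (fun=> 1) s).
  by apply: eq_bigr => t _; rewrite mulr1.
rewrite glauber_opE.
under eq_bigr do (under eq_bigr do rewrite mulr1; rewrite sum_update_prob// mulr1).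
by rewrite sumr_const card_ord -[LHS]mulr_natr mulVf// pnatr_eq0 -lt0n.
Qed.

Lemma glauber_detailed_balance {R : realType} (q n : nat) (r beta : R)
    (s t : config q n) :
  boltzmann r beta s * glauber r beta s t = boltzmann r beta t * glauber r beta t s.
Proof.
rewrite [LHS]mulr_sumr [RHS]mulr_sumr; apply: eq_bigr => i _.
move: (boltzmann r beta s) (boltzmann r beta t) (site_detailed_balance r beta s t i).
by move=> x y st; rewrite [LHS]mulrCA [RHS]mulrCA st.
Qed.

(** The prior is the same for every configuration, so its value at [t] serves as the constant. *)
Lemma gibbs_boltzmann {R : realType} (q n : nat) (r beta : R) (t : config q n) :
  exists c : R, forall s : config q n, gibbs r beta s = boltzmann r beta s * c.
Proof.
by exists (prior R t / \sum_(w : config q n) boltzmann r beta w * prior R w) => s;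
  rewrite mulrA.
Qed.

Lemma gibbs_stationary {R : realType} (q n : nat) (r beta : R) (t : config q n) :
  (0 < q)%N -> (0 < n)%N ->
  \sum_s gibbs r beta s * glauber r beta s t = gibbs r beta t.
Proof.
move=> q0 n0; have [c gE] := gibbs_boltzmann r beta t.
transitivity (\sum_s boltzmann r beta t * c * glauber r beta t s); last first.
  by rewrite -mulr_sumr sum_glauber// mulr1 gE.
apply: eq_bigr => s _; rewrite gE [LHS]mulrAC.
by rewrite [X in X * c = _]glauber_detailed_balance [LHS]mulrAC.
Qed.

(** * Mixing *)

Lemma average_close {R : realType} (T : finType) (mu F : T -> R) (c d : R) :
  (forall x, 0 <= mu x) -> \sum_x mu x = 1 -> (forall x, `|c - F x| <= d) ->
  `|c - \sum_x mu x * F x| <= d.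
Proof.
move=> mu0 mu1 cF.
have -> : c - \sum_x mu x * F x = \sum_x mu x * (c - F x).
  under [RHS]eq_bigr do rewrite mulrBr.
  by rewrite sumrB -mulr_suml mu1 mul1r.
apply: le_trans (ler_norm_sum _ _ _) _.
rewrite -[leRHS]mul1r -mu1 mulr_suml; apply: ler_sum => x _.
by rewrite normrM ger0_norm// ler_wpM2l.
Qed.

(** The contraction is iterated on [f s = P^t(s, A)]. By stationarity the Gibbs measure of [A] is an
    average of such values, so comparing two starting states suffices. *)
Lemma mix_dist_le {R : realType} (q n : nat) (r beta kappa L E : R) (t : nat) :
  (0 < q)%N -> (0 < n)%N -> 0 < kappa -> kappa <= n%:R -> 0 <= L -> 0 <= E ->
  (forall (f : config q n -> R) (A B : R), 0 <= A ->
    (forall s u : config q n,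
      f s - f u <= A * (hamming s u + L * n%:R * (potential s + potential u)) + B) ->
    forall s u : config q n,
    glauber_op r beta f s - glauber_op r beta f u <=
    A * ((1 - kappa / n%:R) *
      (hamming s u + L * n%:R * (potential s + potential u)) + E / n%:R ^+ 2) + B) ->
  mix_dist q n r beta t <=
  (1 - kappa / n%:R) ^+ t * ((1 + 2 * L * q%:R) * n%:R) + E / kappa / n%:R.
Proof.
move=> q0 n0 k0 kn L0 E0 contr.
have N0 : 0 < n%:R :> R by rewrite ltr0n.
set rho := 1 - kappa / n%:R.
have rho0 : 0 <= rho by rewrite subr_ge0 ler_pdivrMr// mul1r.
set X := _ + _.
have X0 : 0 <= X.
  by rewrite addr_ge0 ?divr_ge0 ?(ltW k0)// mulr_ge0 ?exprn_ge0// mulr_ge0// addr_ge0// !mulr_ge0.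
have Phi0 (s u : config q n) : 0 <= L * n%:R * (potential s + potential u).
  by rewrite mulr_ge0 ?addr_ge0 ?potential_ge0// mulr_ge0.
have key (A : {set config q n}) (s u : config q n) :
    \sum_(y in A) iter_kernel (glauber r beta) t s y -
    \sum_(y in A) iter_kernel (glauber r beta) t u y <= X.
  pose f t s := \sum_(y in A) iter_kernel (glauber r beta) t s y.
  (* The constant [E / (kappa n)] is the fixed point of [v |-> (1 - kappa/n) v + E / n^2]. At time
     0, indicators can differ only when the Hamming distance is at least 1. *)
  have bound t0 (s0 u0 : config q n) : f t0 s0 - f t0 u0 <=
      rho ^+ t0 * (hamming s0 u0 + L * n%:R * (potential s0 + potential u0)) +
      E / kappa / n%:R * (1 - rho ^+ t0).
    elim: t0 s0 u0 => [|t0 IH] s0 u0.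
      rewrite /f !iter_kernel0 expr0 mul1r subrr mulr0 addr0.
      have [->|su] := eqVneq s0 u0.
        by rewrite subrr addr_ge0// sumr_ge0.
      have [i si] : exists i, s0 i != u0 i.
        apply/existsP; apply: contraNT su; rewrite negb_exists => /forallP H.
        by apply/eqP/ffunP => i; apply/eqP/negPn; exact: H.
      apply: (@le_trans _ _ 1); first by case: (s0 \in A); case: (u0 \in A); rewrite /=; lra.
      rewrite -[leLHS]addr0 lerD// /hamming (bigD1 i)//= si lerDl.
      exact: sumr_ge0.
    have := contr (f t0) (rho ^+ t0) (E / kappa / n%:R * (1 - rho ^+ t0))
      (exprn_ge0 _ rho0) IH s0 u0.
    have opE v : glauber_op r beta (f t0) v = f t0.+1 v by rewrite /f iter_kernelS.
    rewrite !opE -/rho => /le_trans; apply.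
    rewrite le_eqVlt; apply/orP; left; apply/eqP; rewrite (exprS rho).
    move: (rho ^+ t0) (hamming s0 u0 + _) => w Phi.
    by rewrite /rho; field; rewrite !gt_eqF.
  apply: le_trans (bound t s u) _; rewrite lerD//.
    apply: ler_wpM2l; first exact: exprn_ge0.
    apply: (@le_trans _ _ (n%:R + L * n%:R * (q%:R + q%:R))).
      apply: lerD; first exact: hamming_le.
      by apply: ler_wpM2l; [rewrite mulr_ge0|apply: lerD; exact: potential_le].
    lra.
  by rewrite ler_piMr ?divr_ge0 ?(ltW k0)// gerBl exprn_ge0.
apply: bigmax_le => // x _; apply: bigmax_le => // A _.
rewrite -(stationary_iter A t (fun y => gibbs_stationary r beta y q0 n0)).
apply: average_close => [s||s]; [exact: gibbs_ge0|exact: sum_gibbs|].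
by rewrite ler_norml key andbT lerNl opprB key.
Qed.

Lemma pow_le_expR {R : realType} (x : R) (t : nat) :
  0 <= 1 - x -> (1 - x) ^+ t <= expR (- (x * t%:R)).
Proof.
move=> x1; rewrite -mulNr expRM_natr; apply: lerXn2r; rewrite ?nnegrE ?expR_ge0//.
exact: expR_ge1Dx.
Qed.

Unset Implicit Arguments.

Theorem corollary10p5 (R : realType) (q : nat) (r beta : R)
  (hq : (2 <= q)%N) (hr : 2 <= r) (hbeta : 0 < beta)
  (hbeta_s : (beta%:E < beta_s q r)%E) :
  forall eps : R, 0 < eps < 1 ->
    exists C : R, \forall n \near \oo,
      (mixing_time q n r beta eps <= (C * (n%:R * ln n%:R))%:E)%E.
Proof.
move=> eps /andP[eps0 _].
(* A supremum above [beta] yields an admissible [b] strictly above it, the room needed for all the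
   gaps. *)
have [_ [b [_ hb] <-]] := ereal_sup_gt hbeta_s.
rewrite lte_fin => bb.
have [kappa [L [E [N [k0 L0 E0 contr]]]]] :=
  glauber_contraction hq hr hbeta bb hb.
(* The summand 1 absorbs the rounding of [x] up to an integer, because [n ln n >= 1]. *)
exists (2 / kappa + 1).
(* [kappa] keeps [1 - kappa / n] nonnegative, [expR 1] gives [ln n >= 1], and the last bound brings
   the final [O(1/n)] below [eps]. *)
pose M := Num.max (Num.max N kappa)
  (Num.max (expR 1) ((1 + 2 * L * q%:R + E / kappa) / eps)).
near=> n.
have : M <= n%:R by near: n; exact: nbhs_infty_ger.
rewrite !ge_max => /andP[/andP[nN nk] /andP[ne neps]].
have N0 : 0 < n%:R :> R by exact: lt_le_trans nk.
have n0 : (0 < n)%N by rewrite -(ltr0n R).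
have ln1 : 1 <= ln n%:R :> R.
  by rewrite -[leLHS]expRK ler_ln ?posrE ?expR_gt0.
have n1 : 1 <= n%:R :> R by rewrite ler1n.
pose x := 2 / kappa * (n%:R * ln n%:R) : R.
have nln1 : 1 <= n%:R * ln n%:R :> R by rewrite -[leLHS]mul1r ler_pM.
have x0 : 0 <= x by rewrite mulr_ge0 ?divr_ge0 ?(ltW k0)//; lra.
pose t := (Num.trunc x).+1.
have xt : x <= t%:R by apply/ltW; exact: truncnS_gt.
have tx : t%:R <= x + 1 by rewrite /t -natr1 lerD2r truncn_le.
apply: (@le_trans _ _ (t%:R)%:E); last first.
  by rewrite lee_fin mulrDl mul1r -/x; lra.
apply: ereal_inf_lbound; exists t => //=.
apply: le_trans (mix_dist_le t (ltnW hq) n0 k0 nk L0 E0 (contr n nN)) _.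
have kn : 0 <= 1 - kappa / n%:R by rewrite subr_ge0 ler_pdivrMr// mul1r.
(* The factor 2 in [x] produces [n^-2], which leaves [1/n] after multiplication by the initial
   distance of order [n]. *)
have pw : (1 - kappa / n%:R) ^+ t <= n%:R ^- 2.
  apply: le_trans (pow_le_expR _ kn) _.
  have -> : n%:R ^- 2 = expR (- (2 * ln n%:R)) :> R.
    by rewrite expRN expRM_natl lnK ?posrE.
  rewrite ler_expR lerN2.
  have -> : 2 * ln n%:R = kappa / n%:R * x :> R by rewrite /x; field; rewrite !gt_eqF.
  by rewrite ler_wpM2l// divr_ge0 ?ltW.
have Q0 : 0 <= 1 + 2 * L * q%:R by rewrite addr_ge0// !mulr_ge0.
apply: (@le_trans _ _ (n%:R ^- 2 * ((1 + 2 * L * q%:R) * n%:R) + E / kappa / n%:R)).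
  by rewrite lerD2r ler_wpM2r// mulr_ge0.
have -> : n%:R ^- 2 * ((1 + 2 * L * q%:R) * n%:R) + E / kappa / n%:R =
  (1 + 2 * L * q%:R + E / kappa) / n%:R by field; rewrite !gt_eqF.
by rewrite ler_pdivrMr// (mulrC eps) -ler_pdivrMr.
Unshelve. all: by end_near.
Qed.
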